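(* Let $K_a\ge 1$ be an integer and $P>0$. Let $H\sim\mathcal{CN}(0,1)$, $G=|H|^2$, and let $Z_1,Z_2,\dots$ be i.i.d. $\mathcal{CN}(0,1)$, independent of $H$. For $n\ge 2$ define $$L_n=n\ln(1+PG)+\sum_{i=1}^{n}\left(1-\left|\sqrt{PG}\,Z_i-\sqrt{1+PG}\right|^2\right),$$ $$S_n=n\ln(1+PG)+\sum_{i=1}^n \left(1-\frac{\left|\sqrt{PG}\,Z_i-1\right|^2}{1+PG}\right).$$ Then for every $n\ge 2$ and every $0<\epsilon<1$, any $(M,n-1,\epsilon)$ random-access code for the $K_a$-user quasi-static Rayleigh fading MAC satisfying the maximum power constraint $P$ satisfies $$\ln M\leq \ln K_a+\ln\frac{1}{\mathbb{P}\left[L_n\geq n\gamma_n\right]},$$ where $\gamma_n$ is the solution of $$\mathbb{P}\left[S_n\leq n\gamma_n\right]=\epsilon.$$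
   Context: $\mathcal{CN}(0,1)$ is the standard circularly symmetric complex normal distribution; $\mathcal{CN}(0,I_m)$ is its $m$-dimensional i.i.d. version. $[M]=\{1,\dots,M\}$ and $\binom{[M]}{K_a}$ is the set of $K_a$-element subsets of $[M]$. The $K_a$-user quasi-static Rayleigh fading MAC of blocklength $m$: for inputs $X_1,\dots,X_{K_a}\in\mathbb{C}^m$ the output is $Y=\sum_{i=1}^{K_a}H_iX_i+Z$, where $Z\sim\mathcal{CN}(0,I_m)$ and $H_1,\dots,H_{K_a}$ are i.i.d. $\mathcal{CN}(0,1)$ scalars (constant over the block), with $(H_i)_i$, $Z$ and the inputs independent. The realizations $H_i$ are known neither to the transmitters nor to the receiver. An $(M,m,\epsilon)$ random-access code for this channel is a pair of (possibly randomized) maps $f:[M]\to\mathbb{C}^m$ (a common encoder used by all users) and $g:\mathbb{C}^m\to\binom{[M]}{K_a}$ (the decoder) such that, if $W_1,\dots,W_{K_a}$ are independent and uniform on $[M]$ and $X_j=f(W_j)$, then $$\frac1{K_a}\sum_{j=1}^{K_a}\mathbb{P}[E_j]\le\epsilon,\qquad E_j=\{W_j\notin g(Y)\}\cup\{W_j=W_i\text{ for some }i\ne j\}.$$ The maximum power constraint $P$ for a code of blocklength $m$ is $\|f(w)\|^2\le mP$ for all $w\in[M]$. *)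

(* Defs.v *)
From HB Require Import structures.
From mathcomp Require Import all_boot all_order all_algebra.
From mathcomp Require Import finmap.
From mathcomp Require Import complex.
From mathcomp Require Import all_classical all_reals all_analysis.

Set Implicit Arguments.
Unset Strict Implicit.
Unset Printing Implicit Defensive.

Import Order.TTheory GRing.Theory Num.Theory.
Import numFieldNormedType.Exports.

Local Open Scope classical_set_scope.
Local Open Scope ring_scope.

HB.instance Definition _ (R : realType) := isPointed.Build R[i] (0 : R[i]).

Definition complex_pair (R : realType) (z : R[i]) : R * R :=
  (complex.Re z, complex.Im z).

(* The Borel sigma-algebra of C, identified with R x R. *)
Definition complex_measurable (R : realType) : set (set R[i]) :=
  preimage_set_system setT (@complex_pair R)
    (@measurable _ ((R : measurableType _) * (R : measurableType _))%type).

Lemma complex_measurable0 (R : realType) : complex_measurable (@set0 R[i]).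
Proof. by exists set0 => //; rewrite preimage_set0 setI0. Qed.

Lemma complex_measurableC (R : realType) (A : set R[i]) :
  complex_measurable A -> complex_measurable (~` A).
Proof.
by move=> [B mB <-]; exists (~` B); [exact: measurableC|rewrite !setTI preimage_setC].
Qed.

Lemma complex_measurable_bigcup (R : realType) (F : (set R[i])^nat) :
  (forall i, complex_measurable (F i)) -> complex_measurable (\bigcup_i F i).
Proof.
move=> mF; have /choice[B BF] i : exists B,
    measurable B /\ setT `&` @complex_pair R @^-1` B = F i.
  by have [B mB BF] := mF i; exists B.
exists (\bigcup_i B i); first by apply: bigcup_measurable => i _; case: (BF i).
rewrite setTI preimage_bigcup; apply: eq_bigcupr => i _.
by have [_ <-] := BF i; rewrite setTI.
Qed.

HB.instance Definition _ (R : realType) :=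
  @isMeasurable.Build default_measure_display R[i] (@complex_measurable R)
    (@complex_measurable0 R) (@complex_measurableC R)
    (@complex_measurable_bigcup R).

(* The law CN(0,1): independent real and imaginary parts, each N(0,1/2)
   (normal_prob takes the standard deviation). *)
Definition CN01 (R : realType) : set R[i] -> \bar R :=
  let s : R := Num.sqrt (2^-1) in
  pushforward (normal_prob 0 s \x normal_prob 0 s)%E
    (fun p : R * R => (p.1 +i* p.2)%C).

Section independence.
Context d (Omega : measurableType d) (R : realType) (Pr : probability Omega R).

Definition mutual_independence (I : choiceType) (F : I -> set (set Omega)) :=
  forall (J : {fset I}) (A : I -> set Omega),
    (forall i, i \in J -> F i (A i)) ->
    Pr (\bigcap_(i in [set` J]) A i) = (\prod_(i <- J) Pr (A i))%E.

Definition sigma_rv d' (T : measurableType d') (X : Omega -> T) :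
  set (set Omega) := preimage_set_system setT X measurable.

(* For variables with values in a finite type, which carries the discrete
   sigma-algebra. *)
Definition sigma_fin (T : finType) (X : Omega -> T) : set (set Omega) :=
  preimage_set_system setT X setT.

Definition sum_family (I J : Type) (F : I -> set (set Omega))
    (G : J -> set (set Omega)) (k : I + J) : set (set Omega) :=
  match k with inl i => F i | inr j => G j end.

Definition is_CN01 (X : Omega -> R[i]) :=
  forall A, measurable A -> Pr (X @^-1` A) = CN01 A.

End independence.

(* A pair of randomized maps [M] -> C^m and C^m -> binom([M], Ka).  A randomized
   map is a deterministic map with an extra argument, the value of a random
   seed of prescribed law.  This is an (M, m, eps) random-access code when its
   average_error, defined below, is at most eps. *)
Record randomized_code (R : realType) (Ka M m : nat)
    dU (U : measurableType dU) dV (V : measurableType dV) := RandomizedCode {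
  encoder : 'I_M -> {mfun U >-> m.-tuple R[i]} ;
  encoder_law : probability U R ;
  decoder : m.-tuple R[i] * V -> {set 'I_M} ;
  decoder_measurable : forall s, measurable (decoder @^-1` [set s]) ;
  decoder_card : forall yv, #|decoder yv| = Ka ;
  decoder_law : probability V R }.

Definition max_power_constraint (R : realType) (Ka M m : nat)
    dU (U : measurableType dU) dV (V : measurableType dV)
    (c : randomized_code R Ka M m U V) (P : R) :=
  forall w, {ae encoder_law c, forall u,
    \sum_(k < m) Normc.normc (tnth (encoder c w u) k) ^+ 2 <= m%:R * P}.

(* The code c used by Ka users over the quasi-static Rayleigh fading MAC.  The
   seeds are private: each user and the receiver draw their own. *)
Record mac_use (R : realType) (Ka M m : nat)
    dU (U : measurableType dU) dV (V : measurableType dV)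
    (c : randomized_code R Ka M m U V)
    d (Omega : measurableType d) (Pr : probability Omega R) := MacUse {
  message : 'I_Ka -> Omega -> 'I_M ;
  encoder_seed : 'I_Ka -> {RV Pr >-> U} ;
  fading : 'I_Ka -> {RV Pr >-> R[i]} ;
  noise : 'I_m -> {RV Pr >-> R[i]} ;
  decoder_seed : {RV Pr >-> V} ;
  message_measurable : forall j w, measurable (message j @^-1` [set w]) ;
  message_uniform : forall j w,
    Pr (message j @^-1` [set w]) = (M%:R^-1)%:E ;
  encoder_seed_law : forall j A, measurable A ->
    Pr (encoder_seed j @^-1` A) = encoder_law c A ;
  fading_law : forall j, is_CN01 Pr (fading j) ;
  noise_law : forall k, is_CN01 Pr (noise k) ;
  decoder_seed_law : forall A, measurable A ->
    Pr (decoder_seed @^-1` A) = decoder_law c A ;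
  mac_independence : mutual_independence Pr
    (sum_family (fun j => sigma_fin (message j))
    (sum_family (fun j => sigma_rv (encoder_seed j))
    (sum_family (fun j => sigma_rv (fading j))
    (sum_family (fun k => sigma_rv (noise k))
                (fun _ : unit => sigma_rv decoder_seed))))) }.

Section mac.
Context (R : realType) (Ka M m : nat) dU (U : measurableType dU)
  dV (V : measurableType dV) (c : randomized_code R Ka M m U V)
  d (Omega : measurableType d) (Pr : probability Omega R) (a : mac_use c Pr).

Definition channel_input (j : 'I_Ka) (o : Omega) : m.-tuple R[i] :=
  encoder c (message a j o) (encoder_seed a j o).

Definition channel_output (o : Omega) : m.-tuple R[i] :=
  [tuple \sum_(j < Ka) fading a j o * tnth (channel_input j o) k + noise a k o
     | k < m].

Definition error_event (j : 'I_Ka) : set Omega :=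
  [set o | message a j o \notin decoder c (channel_output o, decoder_seed a o)]
  `|` [set o | exists2 i, i != j & message a j o = message a i o].

Definition average_error : R :=
  Ka%:R^-1 * \sum_(j < Ka) fine (Pr (error_event j)).

End mac.

Section information_sums.
Context (R : realType) (P : R) d (Omega : measurableType d)
  (H : Omega -> R[i]) (Z : nat -> Omega -> R[i]).

Definition fading_gain (o : Omega) : R := Normc.normc (H o) ^+ 2.

Local Notation PG o := (P * fading_gain o).

(* Z i stands for the (i+1)-st noise variable. *)
Definition info_L (n : nat) (o : Omega) : R :=
  n%:R * ln (1 + PG o) +
  \sum_(i < n) (1 - Normc.normc
    ((Num.sqrt (PG o))%:C%C * Z i o - (Num.sqrt (1 + PG o))%:C%C) ^+ 2).

Definition info_S (n : nat) (o : Omega) : R :=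
  n%:R * ln (1 + PG o) +
  \sum_(i < n) (1 - Normc.normc
    ((Num.sqrt (PG o))%:C%C * Z i o - 1) ^+ 2 / (1 + PG o)).

End information_sums.

(* Main.v *)
Require Import Defs.
From HB Require Import structures.
From mathcomp Require Import all_boot all_order all_algebra.
From mathcomp Require Import finmap.
From mathcomp Require Import complex.
From mathcomp Require Import all_classical all_reals all_analysis.
From mathcomp Require Import measurable_realfun ring lra.

(* Fix a user [j] whose error probability is at most [eps] and let a genie reveal
   to the receiver the fading of [j] and everything but the message of [j] and
   the noise. Given the fading [h], compare the true channel [Y = h x + Z] with
   the reference channel [Y = sqrt (1 + P |h|^2) Z], whose output is independent
   of the message and under which a list of [Ka] messages is correct with
   probability at most [Ka / M]. The codeword is completed by one symbol so that
   its power is exactly [n P]; by the spherical symmetry of the Gaussian law, the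
   log-likelihood ratio of the two channels is then distributed as [S_n] under
   the first one and as [L_n] under the second one, whatever the codeword. The
   Neyman-Pearson inequality gives
     P[correct] + e^(n gamma) P[L_n > n gamma]
       <= P[S_n > n gamma] + e^(n gamma) Ka / M,
   and [P[S_n > n gamma] = 1 - eps <= P[correct]]. Finally [L_n] has no atoms,
   since given [h <> 0] it is a non-degenerate quadratic polynomial in [Re Z_1],
   and [P[L_n > n gamma] > 0] because [S_n > n gamma] has positive probability. *)

Set Implicit Arguments.
Unset Strict Implicit.
Unset Printing Implicit Defensive.

Import Order.TTheory GRing.Theory Num.Theory.
Import numFieldNormedType.Exports.

Local Open Scope classical_set_scope.
Local Open Scope ring_scope.

(** * Change of variables and densities *)

(** Both channels are images of one Gaussian vector [z]: the true output is [translate a z], the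
    reference output [dilate s z] with [s = sqrt (1 + g)], where [1 + g] is the output variance that
    a Gaussian input of power [P] would produce. The change of variables between the two images,
    built up from one real coordinate, takes the place of densities on C^n. The seeds live in
    arbitrary measurable spaces, so what the genie reveals is kept as a sub-sigma-algebra of the
    given sample space rather than as a tuple of variables. Neyman-Pearson is applied with this
    environment and the fading frozen; since the threshold [n gamma] is the same for all their
    values and the inequality is linear in the four probabilities, it can then be integrated over
    both. The complement of [S_n <= n gamma] forces a strict test, whereas the conclusion has
    [L_n >= n gamma]: the absence of atoms bridges the two. Positivity is needed because
    [ln (1 / p)] is minus [ln p] in a meaningful sense only for [p > 0]. *)

Lemma ge0_integral_law d1 d2 (T1 : measurableType d1) (T2 : measurableType d2)
    (R : realType) (mu : {measure set T1 -> \bar R})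
    (nu : {measure set T2 -> \bar R}) (f : T1 -> T2) (g : T2 -> \bar R) :
  measurable_fun [set: T1] f ->
  (forall A, measurable A -> nu A = mu (f @^-1` A)) ->
  measurable_fun [set: T2] g -> (forall x, 0 <= g x)%E ->
  (\int[nu]_x g x = \int[mu]_x g (f x))%E.
Proof.
move=> mf law mg g0.
transitivity (\int[pushforward mu f]_x g x)%E; last first.
  by rewrite ge0_integral_pushforward.
by apply: eq_measure_integral => //= A mA _; exact: law.
Qed.

Section density.
Local Open Scope ereal_scope.
Context d (T : measurableType d) (R : realType).
Variables (mu nu : {measure set T -> \bar R}) (p : T -> R).
Hypothesis mp : measurable_fun [set: T] p.
Hypothesis p0 : (forall x, 0 <= p x)%R.
Hypothesis nuE : forall A, measurable A -> nu A = \int[mu]_(x in A) (p x)%:E.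

Import HBNNSimple.

Let integral_density_nnsfun (g : {nnsfun T >-> R}) :
  \int[nu]_x (g x)%:E = \int[mu]_x ((g x)%:E * (p x)%:E).
Proof.
under eq_integral do rewrite fimfunE -fsumEFin//.
rewrite ge0_integral_fsum//; last 2 first.
  - by move=> r; exact/measurable_EFinP/measurableT_comp.
  - by move=> n x _; rewrite EFinM nnfun_muleindic_ge0.
under [RHS]eq_integral.
  move=> x _; rewrite fimfunE -fsumEFin// ge0_mule_fsuml; last first.
    by move=> r; rewrite EFinM nnfun_muleindic_ge0.
  over.
rewrite ge0_integral_fsum//; last 2 first.
  - move=> r; apply: emeasurable_funM; apply/measurable_EFinP => //.
    exact/measurable_funM.
  - move=> n x _; apply: mule_ge0; last by rewrite lee_fin.
    by rewrite EFinM nnfun_muleindic_ge0.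
apply: eq_fsbigr => r _.
rewrite integralZl_indic_nnsfun//= integral_indic//= setIT nuE//.
under [RHS]eq_integral do rewrite EFinM -muleA.
(* Pulling [r] out of the integral needs [0 <= r]; a negative [r] has an empty preimage, so both
   sides vanish. *)
have [r0|r0] := ltP r 0%R.
  rewrite preimage_nnfun0//= integral_set0 mule0 integral0_eq// => x _.
  by rewrite indicE in_set0 mul0e mule0.
rewrite ge0_integralZl//; last 2 first.
  - apply: emeasurable_funM; apply/measurable_EFinP => //.
  - by move=> x _; rewrite mule_ge0 ?lee_fin ?p0.
congr (_ * _); rewrite integral_mkcond; apply: eq_integral => x _.
rewrite patchE indicE; case: ifPn => _; by rewrite ?mul1e ?mul0e.
Qed.

Lemma ge0_integral_density (f : T -> \bar R) : measurable_fun [set: T] f ->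
  (forall x, 0 <= f x) -> \int[nu]_x f x = \int[mu]_x (f x * (p x)%:E).
Proof.
move=> mf f0; pose f_ := nnsfun_approx measurableT mf.
have f_cvg x : (f_ n x)%:E @[n --> \oo] --> f x.
  by apply: cvg_nnsfun_approx => // y _; exact: f0.
transitivity (limn (fun n => \int[nu]_x (f_ n x)%:E)).
  rewrite -monotone_convergence//=.
  - by apply: eq_integral => x _; apply/esym/cvg_lim => //=.
  - by move=> n; apply/measurable_EFinP.
  - by move=> n x _; rewrite lee_fin.
  - by move=> x _ a b ab; rewrite lee_fin//; exact/lefP/nd_nnsfun_approx.
transitivity (limn (fun n => \int[mu]_x ((f_ n x)%:E * (p x)%:E))).
  by congr (limn _); apply/funext => n; exact: integral_density_nnsfun.
rewrite -monotone_convergence//=.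
- apply: eq_integral => x _; apply/cvg_lim => //=.
  by apply: cvgeZr => //; exact: f_cvg.
- by move=> n; apply: emeasurable_funM; apply/measurable_EFinP.
- by move=> n x _; rewrite mule_ge0// lee_fin.
- move=> x _ a b ab; rewrite lee_wpmul2r ?lee_fin//.
  exact/lefP/nd_nnsfun_approx.
Qed.

End density.

Section affine_substitution.
Context {R : realType}.
Local Notation mu := (@lebesgue_measure R).

Lemma measurable_affine (a b : R) : measurable_fun [set: R] (fun t => b * t + a).
Proof. by apply: measurable_funD => //; exact: measurable_funM. Qed.

(** The image of Lebesgue measure under [t |-> b * t + a], multiplied by [b], gives every half-open
    interval its length, hence is Lebesgue measure. *)
Let integral_affine_gt0 (a b : R) (F : R -> \bar R) : 0 < b ->
  measurable_fun [set: R] F -> (forall x, 0 <= F x)%E ->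
  (\int[mu]_x F x = b%:E * \int[mu]_x F (b * x + a)%R)%E.
Proof.
move=> b0 mF F0; pose f : measurableTypeR R -> measurableTypeR R := fun t => b * t + a.
have mf : measurable_fun [set: measurableTypeR R] f by exact: measurable_affine.
have -> : (\int[mu]_x F (b * x + a)%R = \int[pushforward mu f]_x F x)%E.
  by rewrite (ge0_integral_pushforward mf mu).
rewrite -(ge0_integral_mscale _ measurableT (NngNum (ltW b0)))//.
apply: eq_measure_integral => //= A mA _.
apply: lebesgue_measure_unique => //= _ [[x y]] _ <- /=.
rewrite /mscale/= /pushforward.
have -> : f @^-1` `]x, y] = `](x - a) / b, (y - a) / b]%classic.
  apply/seteqP; split => t /=; rewrite !in_itv/= /f ltr_pdivrMr// ler_pdivlMr//;
  by rewrite ltrBlDr lerBrDr (mulrC t).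
rewrite !lebesgue_measure_itv/= !lte_fin ltr_pM2r ?invr_gt0// ltrD2r.
case: ifPn => xy; last by rewrite mule0.
by rewrite -!EFinD -EFinM; congr EFin; field; rewrite gt_eqF.
Qed.

Lemma ge0_integral_affine (a b : R) (F : R -> \bar R) : b != 0 ->
  measurable_fun [set: R] F -> (forall x, 0 <= F x)%E ->
  (\int[mu]_x F x = `|b|%:E * \int[mu]_x F (b * x + a)%R)%E.
Proof.
move=> b0 mF F0; have [b_gt0|b_le0] := ltP 0 b.
  by rewrite gtr0_norm//; exact: integral_affine_gt0.
have bN : 0 < - b by rewrite oppr_gt0 lt_neqAle b0.
rewrite ler0_norm//.
have mN : measurable_fun [set: measurableTypeR R] (-%R : measurableTypeR R -> measurableTypeR R).
  exact: oppr_measurable.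
have -> : (\int[mu]_x F x = \int[mu]_x F (- x)%R)%E.
  apply: ge0_integral_law => // A mA; apply/esym; exact: lebesgue_measureN.
rewrite (@integral_affine_gt0 (- a) (- b))//; last exact: measurableT_comp mN.
by congr (_ * _)%E; apply: eq_integral => x _; congr F; ring.
Qed.

End affine_substitution.

(** * Gaussian measures on R, C and C^n *)

Section half_normal.
Context {R : realType}.
Local Notation mu := (@lebesgue_measure R).

(** The law of the real and imaginary parts of [CN01]: variance 1/2 makes the density proportional
    to [exp (- t ^+ 2)]. *)
Definition half_normal := @normal_prob R 0 (Num.sqrt 2^-1).

HB.instance Definition _ := Probability.on half_normal.

Local Notation nu := half_normal.

Let half_pdf (t : R) : R := normal_peak (Num.sqrt (2^-1 : R)) * expR (- t ^+ 2).

Let half_pdfE : normal_pdf 0 (Num.sqrt 2^-1) = half_pdf.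
Proof.
rewrite normal_pdfE; last by rewrite gt_eqF// sqrtr_gt0 invr_gt0.
apply/funext => t; rewrite /half_pdf /normal_fun subr0 sqr_sqrtr ?invr_ge0//.
have -> : (2^-1 : R) *+ 2 = 1 by field.
by rewrite divr1.
Qed.

Let half_pdf_ge0 t : 0 <= half_pdf t.
Proof. by rewrite mulr_ge0 ?normal_peak_ge0 ?expR_ge0. Qed.

Let measurable_half_pdf : measurable_fun [set: R] half_pdf.
Proof. by rewrite -half_pdfE; exact: measurable_normal_pdf. Qed.

Let integral_half_normal (F : R -> \bar R) : measurable_fun [set: R] F ->
  (forall x, 0 <= F x)%E -> (\int[nu]_x F x = \int[mu]_x (F x * (half_pdf x)%:E))%E.
Proof.
move=> mF F0; apply: ge0_integral_density => //.
by move=> A mA; rewrite -half_pdfE.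
Qed.

(** Both sides equal the Lebesgue integral of [G], through [y = a + t] on the left and
    [y = sigma * t] on the right. The extra factor is the likelihood ratio of [a + t] against
    [sigma * t], read at [y = sigma * t]. *)
Lemma half_normal_shift (a sigma : R) (F : R -> \bar R) : 0 < sigma ->
  measurable_fun [set: R] F -> (forall x, 0 <= F x)%E ->
  (\int[nu]_t F (a + t)%R = \int[nu]_t (F (sigma * t)%R *
     (sigma * expR (t ^+ 2 - (sigma * t - a) ^+ 2))%:E))%E.
Proof.
move=> s0 mF F0.
have maff (b c : R) : measurable_fun [set: R] (fun t : R => b * t + c).
  exact: measurable_affine.
pose G y := (F y * (half_pdf (y - a))%:E)%E.
have mG : measurable_fun [set: R] G.
  apply: emeasurable_funM => //; apply/measurable_EFinP.
  by apply: (measurableT_comp measurable_half_pdf); exact: measurable_funB.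
have G0 y : (0 <= G y)%E by rewrite mule_ge0// lee_fin.
rewrite integral_half_normal//; last first.
  by apply: (measurableT_comp mF); exact: measurable_funD.
transitivity (\int[mu]_y G y)%E.
  rewrite (@ge0_integral_affine _ a 1 G)// normr1 mul1e.
  by apply: eq_integral => t _; rewrite /G mul1r addrK addrC.
rewrite (@ge0_integral_affine _ 0 sigma G)// ?gt_eqF// gtr0_norm//.
rewrite integral_half_normal; last 2 first.
- apply: emeasurable_funM.
    by apply: (measurableT_comp mF); exact: measurable_funM.
  apply/measurable_EFinP; apply: measurable_funM => //.
  apply: measurableT_comp => //; apply: measurable_funB => //.
  apply: measurable_funX; apply: measurable_funB => //; exact: measurable_funM.
- by move=> x; rewrite mule_ge0// lee_fin mulr_ge0 ?expR_ge0// ltW.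
rewrite -ge0_integralZl//; last 2 first.
- apply: (measurableT_comp mG); exact: maff.
- by rewrite lee_fin ltW.
apply: eq_integral => t _; rewrite /G addr0 muleCA -!muleA; congr (_ * _)%E.
rewrite -!EFinM /half_pdf; congr EFin.
have -> : expR (- (sigma * t - a) ^+ 2) =
    expR (t ^+ 2 - (sigma * t - a) ^+ 2) * expR (- t ^+ 2).
  by rewrite -expRD; congr expR; ring.
by ring.
Qed.

Local Notation T2 := (measurableTypeR R * measurableTypeR R)%type.

Lemma measurable_linear2 (a b : R) :
  measurable_fun [set: T2] (fun z : T2 => a * z.1 + b * z.2).
Proof. by apply: measurable_funD; apply: measurable_funM. Qed.

(** Two one-dimensional substitutions. At fixed [y], [u = p * x + q * y] turns the second coordinate
    into [p^-1 * y - q / p * u], because [p ^+ 2 + q ^+ 2 = 1]; at fixed [u], that coordinate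
    becomes the new variable. The factors [|p|] and [|p^-1|] cancel. *)
Let integral_rotation (p q : R) (F : T2 -> \bar R) : p ^+ 2 + q ^+ 2 = 1 ->
  measurable_fun [set: T2] F -> (forall x, 0 <= F x)%E ->
  (\int[mu]_x \int[mu]_y F (p * x + q * y, - q * x + p * y)%R =
   \int[mu]_x \int[mu]_y F (x, y))%E.
Proof.
move=> pq mF F0.
have mlin (a b c d : R) : measurable_fun [set: T2]
    (fun z : T2 => F (a * z.1 + b * z.2, c * z.1 + d * z.2)).
  by apply: (measurableT_comp mF); apply/measurable_fun_pair => /=;
    exact: measurable_linear2.
have mlin1 (a b c d : R) : measurable_fun [set: measurableTypeR R]
    (fun t : measurableTypeR R => F (a * t + b, c * t + d)).
  by apply: (measurableT_comp mF); apply/measurable_fun_pair => /=;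
    exact: measurable_affine.
(* For [p = 0] the first substitution degenerates; the rotation is then an exchange of the
   coordinates up to signs, as [|q| = 1]. *)
have [p0|p0] := eqVneq p 0.
  have q0 : q != 0 by apply: contra_eqN pq => /eqP ->; rewrite p0 expr0n addr0 eq_sym oner_eq0.
  have q1 : `|q| = 1.
    apply/eqP; rewrite -(@eqrXn2 _ 2)// expr1n real_normK ?num_real//.
    by rewrite -pq p0 expr0n add0r.
  rewrite p0; under eq_integral do under eq_integral do rewrite !mul0r addr0 add0r.
  transitivity (\int[mu]_x \int[mu]_y F (y, - q * x)%R)%E.
    apply: eq_integral => x _.
    rewrite [RHS](@ge0_integral_affine _ 0 q)// ?q1 ?mul1e.
      by apply: eq_integral => y _; rewrite addr0.
    have := mlin1 1 0 0 (- q * x).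
    by under eq_fun do rewrite mul1r addr0 mul0r add0r.
  have m1 : measurable_fun [set: measurableTypeR R] (fun x : measurableTypeR R => \int[mu]_y F (y, x))%E.
    exact: (measurable_fun_fubini_tonelli_G (m1 := mu) F).
  transitivity (\int[mu]_x \int[mu]_y F (y, x))%E.
    rewrite [RHS](@ge0_integral_affine _ 0 (- q))// ?oppr_eq0// ?normrN ?q1 ?mul1e.
      by apply: eq_integral => x _; rewrite addr0.
    by move=> x; apply: integral_ge0.
  rewrite [RHS](fubini_tonelli F)//.
have Np0 : 0 < `|p| by rewrite normr_gt0.
have invp : (`|p|%:E * `|p^-1|%:E = 1 :> \bar R)%E.
  by rewrite -EFinM normfV divff// gt_eqF.
transitivity (\int[mu]_y (`|p^-1|%:E * \int[mu]_u F (u, p^-1 * y - q / p * u)%R))%E.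
  rewrite (fubini_tonelli (fun z : T2 => F (p * z.1 + q * z.2, - q * z.1 + p * z.2)))//=.
  apply: eq_integral => y _.
  rewrite [in RHS](@ge0_integral_affine _ (q * y) p)//.
    rewrite muleA (muleC `|p^-1|%:E) invp mul1e; apply: eq_integral => x _.
    congr (F (_, _)).
    have -> : p^-1 * y = (p ^+ 2 + q ^+ 2) * (p^-1 * y) by rewrite pq mul1r.
    by field.
  have := mlin1 1 0 (- (q / p)) (p^-1 * y).
  by under eq_fun do rewrite mul1r addr0 mulNr addrC.
have mH : measurable_fun [set: T2] (fun z : T2 => F (z.2, p^-1 * z.1 - q / p * z.2)).
  have := mlin 0 1 p^-1 (- (q / p)).
  by under eq_fun do rewrite mul0r add0r mul1r mulNr.
have mH1 := measurable_fun_fubini_tonelli_F (m2 := mu) _ mH.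
rewrite ge0_integralZl//; last 2 first.
- exact: mH1.
- by move=> y _; apply: integral_ge0.
rewrite (fubini_tonelli (fun z : T2 => F (z.2, p^-1 * z.1 - q / p * z.2)))//=.
rewrite -ge0_integralZl//; last 2 first.
- exact: (measurable_fun_fubini_tonelli_G (m1 := mu) _ mH).
- by move=> y _; apply: integral_ge0.
apply: eq_integral => u _.
rewrite [RHS](@ge0_integral_affine _ (- (q / p * u)) p^-1)// ?invr_eq0//.
have := mlin1 0 u 1 0.
by under eq_fun do rewrite mul0r add0r mul1r addr0.
Qed.

(** The joint density depends on [x ^+ 2 + y ^+ 2] only, so the rotation invariance of Lebesgue
    measure carries over. *)
Lemma half_normal_rotation (p q : R) (F : T2 -> \bar R) : p ^+ 2 + q ^+ 2 = 1 ->
  measurable_fun [set: T2] F -> (forall x, 0 <= F x)%E ->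
  (\int[nu]_x \int[nu]_y F (p * x + q * y, - q * x + p * y)%R =
   \int[nu]_x \int[nu]_y F (x, y))%E.
Proof.
move=> pq mF F0.
pose w (z : T2) : R := half_pdf z.1 * half_pdf z.2.
have mw : measurable_fun [set: T2] w.
  by apply: measurable_funM; apply: (measurableT_comp measurable_half_pdf).
have w0 z : 0 <= w z by rewrite mulr_ge0.
have dens (G : T2 -> \bar R) : measurable_fun [set: T2] G -> (forall x, 0 <= G x)%E ->
    (\int[nu]_x \int[nu]_y G (x, y) = \int[mu]_x \int[mu]_y (G (x, y) * (w (x, y))%:E))%E.
  move=> mG G0.
  have mG1 x : measurable_fun [set: measurableTypeR R] (fun y => G (x, y)).
    exact: (measurableT_comp mG (pair1_measurable x)).
  rewrite integral_half_normal; last 2 first.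
  - exact: (measurable_fun_fubini_tonelli_F (m2 := nu) _ mG).
  - by move=> x; apply: integral_ge0.
  apply: eq_integral => x _; rewrite (integral_half_normal (mG1 x))// muleC.
  rewrite -ge0_integralZl//; last 3 first.
  - by apply: emeasurable_funM => //; apply/measurable_EFinP.
  - by move=> y _; rewrite mule_ge0// lee_fin.
  - by rewrite lee_fin.
  by apply: eq_integral => y _; rewrite muleCA -EFinM.
pose Fr z := F (p * z.1 + q * z.2, - q * z.1 + p * z.2).
have mFr : measurable_fun [set: T2] Fr.
  by apply: (measurableT_comp mF); apply/measurable_fun_pair => /=;
    exact: measurable_linear2.
have mFw : measurable_fun [set: T2] (fun z => F z * (w z)%:E)%E.
  by apply: emeasurable_funM => //; apply/measurable_EFinP.
have Fw0 z : (0 <= F z * (w z)%:E)%E by rewrite mule_ge0// lee_fin.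
apply: etrans (dens Fr mFr (fun z => F0 _)) _.
apply: etrans (esym (dens F mF F0)).
apply: etrans (integral_rotation pq mFw Fw0).
apply: eq_integral => x _; apply: eq_integral => y _ /=.
congr (_ * _%:E)%E; rewrite /w /half_pdf /= !mulrA.
rewrite ![_ * _ * normal_peak _]mulrAC -!mulrA -!expRD; congr (_ * (_ * expR _)).
transitivity (- (p ^+ 2 + q ^+ 2) * (x ^+ 2 + y ^+ 2)); first by rewrite pq; ring.
by ring.
Qed.

End half_normal.

Section complex_measurability.
Context {R : realType}.

Definition sqnorm (z : R[i]) : R := complex.Re z ^+ 2 + complex.Im z ^+ 2.

Lemma normc_sqr (z : R[i]) : Normc.normc z ^+ 2 = sqnorm z.
Proof. by case: z => x y; rewrite /= sqr_sqrtr// addr_ge0 ?sqr_ge0. Qed.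

Lemma sqnorm_ge0 (z : R[i]) : 0 <= sqnorm z.
Proof. by rewrite addr_ge0 ?sqr_ge0. Qed.

Lemma measurable_complex_pair : measurable_fun [set: R[i]] (@complex_pair R).
Proof. by move=> _ B mB; exists B. Qed.

Lemma measurable_Re : measurable_fun [set: R[i]] (@complex.Re R : R[i] -> R).
Proof. exact: (measurableT_comp measurable_fst measurable_complex_pair). Qed.

Lemma measurable_Im : measurable_fun [set: R[i]] (@complex.Im R : R[i] -> R).
Proof. exact: (measurableT_comp measurable_snd measurable_complex_pair). Qed.

Context d (T : measurableType d).
Implicit Types f g : T -> R[i].

Lemma measurable_complex f :
  measurable_fun [set: T] (fun t => complex.Re (f t)) ->
  measurable_fun [set: T] (fun t => complex.Im (f t)) ->
  measurable_fun [set: T] f.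
Proof.
move=> mr mi _ _ [B mB <-]; rewrite !setTI -[X in measurable X]setTI.
exact: (measurable_fun_pair mr mi).
Qed.

Lemma measurable_complexD f g : measurable_fun [set: T] f ->
  measurable_fun [set: T] g -> measurable_fun [set: T] (fun t => f t + g t).
Proof.
move=> mf mg; apply: measurable_complex.
- under eq_fun do rewrite raddfD.
  by apply: measurable_funD; apply: (measurableT_comp measurable_Re).
- under eq_fun do rewrite raddfD.
  by apply: measurable_funD; apply: (measurableT_comp measurable_Im).
Qed.

Lemma measurable_complexM f g : measurable_fun [set: T] f ->
  measurable_fun [set: T] g -> measurable_fun [set: T] (fun t => f t * g t).
Proof.
move=> mf mg; have [rf ig] := (measurableT_comp measurable_Re mf, measurableT_comp measurable_Im mf).
have [rg ig'] := (measurableT_comp measurable_Re mg, measurableT_comp measurable_Im mg).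
apply: measurable_complex.
- rewrite (_ : (fun t => _) = (fun t => complex.Re (f t) * complex.Re (g t) -
    complex.Im (f t) * complex.Im (g t))); last first.
    by apply/funext => t; case: (f t) (g t) => ? ? [].
  by apply: measurable_funB; apply: measurable_funM.
- rewrite (_ : (fun t => _) = (fun t => complex.Re (f t) * complex.Im (g t) +
    complex.Im (f t) * complex.Re (g t))); last first.
    by apply/funext => t; case: (f t) (g t) => ? ? [].
  by apply: measurable_funD; apply: measurable_funM.
Qed.

Lemma measurable_complex_sum n (f : 'I_n -> T -> R[i]) (p : pred 'I_n) :
  (forall i, measurable_fun [set: T] (f i)) ->
  measurable_fun [set: T] (fun t => \sum_(i < n | p i) f i t).
Proof.
move=> mf; elim: (index_enum _) => [|i s ih].
  by under eq_fun do rewrite big_nil; exact: measurable_cst.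
under eq_fun do rewrite big_cons.
by case: (p i) => //; exact: measurable_complexD.
Qed.

Lemma measurable_real_complex (f : T -> R) : measurable_fun [set: T] f ->
  measurable_fun [set: T] (fun t => (f t)%:C%C).
Proof. by move=> mf; apply: measurable_complex => //=. Qed.

Lemma measurable_sqnorm f : measurable_fun [set: T] f ->
  measurable_fun [set: T] (fun t => sqnorm (f t)).
Proof.
move=> mf; apply: measurable_funD; apply: measurable_funX.
- exact: (measurableT_comp measurable_Re).
- exact: (measurableT_comp measurable_Im).
Qed.

End complex_measurability.

Section complex_normal.
Context {R : realType}.
Local Notation nu := (@half_normal R).
Local Notation T2 := (measurableTypeR R * measurableTypeR R)%type.

Definition complex_of_pair (p : T2) : R[i] := (p.1 +i* p.2)%C.

Lemma measurable_complex_of_pair : measurable_fun [set: T2] complex_of_pair.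
Proof.
by apply: measurable_complex; [exact: measurable_fst|exact: measurable_snd].
Qed.

HB.instance Definition _ :=
  isMeasurableFun.Build _ _ _ _ complex_of_pair measurable_complex_of_pair.

Definition complex_normal : probability R[i] R :=
  distribution (nu \x nu)%E complex_of_pair.

Lemma CN01E : @CN01 R = complex_normal.
Proof. by []. Qed.

Lemma integral_complex_normal (F : R[i] -> \bar R) :
  measurable_fun [set: R[i]] F -> (forall z, 0 <= F z)%E ->
  (\int[complex_normal]_z F z = \int[nu]_x \int[nu]_y F (x +i* y)%C)%E.
Proof.
move=> mF F0; rewrite ge0_integral_distribution//.
apply: (fubini_tonelli1 (F \o complex_of_pair)) => [|z]; last exact: F0.
exact: (measurableT_comp mF measurable_complex_of_pair).
Qed.

Lemma measurable_fun_pairE d (T : measurableType d) (F : T2 -> \bar R)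
    (f g : T -> R) : measurable_fun [set: T2] F ->
  measurable_fun [set: T] f -> measurable_fun [set: T] g ->
  measurable_fun [set: T] (fun t => F (f t, g t)).
Proof.
by move=> mF mf mg; apply: (measurableT_comp mF); exact: measurable_fun_pair.
Qed.

(** [half_normal_shift] is applied to the real and to the imaginary part; the two weights multiply,
    whence the factor [sigma ^+ 2]. *)
Lemma complex_normal_shift (a : R[i]) (sigma : R) (F : R[i] -> \bar R) :
  0 < sigma -> measurable_fun [set: R[i]] F -> (forall z, 0 <= F z)%E ->
  (\int[complex_normal]_z F (a + z)%R =
   \int[complex_normal]_z (F (sigma%:C%C * z)%R *
     (sigma ^+ 2 * expR (sqnorm z - sqnorm (sigma%:C%C * z - a)))%:E))%E.
Proof.
move=> s0 mF F0; rewrite integral_complex_normal//; last first.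
  by apply: (measurableT_comp mF); exact: measurable_complexD.
rewrite integral_complex_normal//; last 2 first.
- apply: emeasurable_funM.
    by apply: (measurableT_comp mF); exact: measurable_complexM.
  apply/measurable_EFinP; apply: measurable_funM => //.
  apply: measurableT_comp => //; apply: measurable_funB; apply: measurable_sqnorm => //.
  by apply: measurable_complexD => //; exact: measurable_complexM.
- by move=> z; rewrite mule_ge0// lee_fin mulr_ge0 ?expR_ge0 ?sqr_ge0.
case: a => u v.
pose G (z : T2) := F (z.1 +i* z.2)%C.
have mG : measurable_fun [set: T2] G by exact: (measurableT_comp mF measurable_complex_of_pair).
have G0 z : (0 <= G z)%E by exact: F0.
pose w (b t : R) := sigma * expR (t ^+ 2 - (sigma * t - b) ^+ 2).
have w0 b t : 0 <= w b t by rewrite mulr_ge0 ?expR_ge0// ltW.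
have mw b : measurable_fun [set: measurableTypeR R] (w b).
  apply: measurable_funM => //; apply: measurableT_comp => //; apply: measurable_funB => //.
  by apply: measurable_funX; apply: measurable_funB => //; exact: measurable_funM.
have mGp (h k : R -> R) : measurable_fun [set: R] h -> measurable_fun [set: R] k ->
    measurable_fun [set: T2] (fun z : T2 => G (h z.1, k z.2)).
  move=> mh mk; apply: (measurable_fun_pairE mG).
  - exact: (measurableT_comp mh measurable_fst).
  - exact: (measurableT_comp mk measurable_snd).
have mG1 x : measurable_fun [set: R] (fun y => G (x, y)).
  exact: (measurableT_comp mG (pair1_measurable x)).
transitivity (\int[nu]_x \int[nu]_y G (u + x, v + y)%R)%E.
  by apply: eq_integral => x _; exact: eq_integral.
rewrite (@half_normal_shift _ u sigma (fun x => \int[nu]_y G (x, v + y)%R)%E)//; last 2 first.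
- apply: (measurable_fun_fubini_tonelli_F (m2 := nu) (fun z => G (z.1, v + z.2))) => //.
  by apply: (mGp id) => //; exact: measurable_funD.
- by move=> x; exact: integral_ge0.
apply: eq_integral => x _.
rewrite (@half_normal_shift _ v sigma (fun y => G (_, y)))//.
rewrite -ge0_integralZr//; last 3 first.
- apply: emeasurable_funM.
    by apply: (measurableT_comp (mG1 _)); exact: measurable_funM.
  by apply/measurable_EFinP; exact: mw.
- by move=> y _; rewrite mule_ge0// lee_fin w0.
- by rewrite lee_fin w0.
apply: eq_integral => y _; rewrite /G /= -muleA -EFinM; congr (F _ * _%:E)%E.
  by apply/eqP; rewrite eq_complex/= !mul0r subr0 addr0 !eqxx.
rewrite mulrACA -expr2 -expRD; congr (_ * expR _).
by rewrite /sqnorm/=; ring.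
Qed.

End complex_normal.

(** * Gaussian vectors as iterated products, and their characterisation on boxes *)

Section tuples.
Context {R : realType}.
Local Notation C := R[i].

Definition tuple_cons n (p : C * n.-tuple C) : n.+1.-tuple C :=
  [the n.+1.-tuple C of p.1 :: p.2].

Lemma measurable_tuple_cons n :
  measurable_fun [set: C * n.-tuple C] (@tuple_cons n).
Proof. exact: measurable_cons. Qed.

HB.instance Definition _ n :=
  isMeasurableFun.Build _ _ _ _ (@tuple_cons n) (@measurable_tuple_cons n).

(** Built by recursion so that an integral unfolds one coordinate at a time, which is what the
    inductions on the dimension use. *)
Fixpoint complex_gauss n : probability (n.-tuple C) R :=
  match n return probability (n.-tuple C) R with
  | 0 => @dirac _ _ [tuple] R
  | k.+1 => distribution (complex_normal \x complex_gauss k)%E (@tuple_cons k)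
  end.

Lemma tnth_tuple_consS n z (t : n.-tuple C) i :
  tnth (tuple_cons (z, t)) (lift ord0 i) = tnth t i.
Proof. by rewrite tnthS. Qed.

Lemma tnth_tuple_cons0 n z (t : n.-tuple C) : tnth (tuple_cons (z, t)) ord0 = z.
Proof. by []. Qed.

Lemma integral_complex_gaussS n (F : n.+1.-tuple C -> \bar R) :
  measurable_fun [set: n.+1.-tuple C] F -> (forall t, 0 <= F t)%E ->
  (\int[complex_gauss n.+1]_t F t =
   \int[complex_normal]_z \int[complex_gauss n]_t F (tuple_cons (z, t)))%E.
Proof.
move=> mF F0; rewrite /= ge0_integral_distribution//.
apply: (fubini_tonelli1 (F \o @tuple_cons n)) => [|z]; last exact: F0.
exact: (measurableT_comp mF (@measurable_tuple_cons n)).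
Qed.

Lemma integral_complex_gauss0 (F : 0.-tuple C -> \bar R) :
  (\int[complex_gauss 0]_t F t = F [tuple])%E.
Proof.
have mF : measurable_fun [set: 0.-tuple C] F.
  rewrite (_ : F = cst (F [tuple])); first exact: measurable_cst.
  by apply/funext => t /=; rewrite (tuple0 t).
by rewrite /= integral_dirac// diracT mul1e.
Qed.

Lemma measurable_mktuple d (T : measurableType d) n (f : 'I_n -> T -> C) :
  (forall i, measurable_fun [set: T] (f i)) ->
  measurable_fun [set: T] (fun t => [tuple f i t | i < n]).
Proof.
move=> mf; apply/measurable_fun_tnthP => i.
by rewrite (_ : _ \o _ = f i)//; apply/funext => t /=; rewrite tnth_mktuple.
Qed.

Definition box n (A : 'I_n -> set C) : set (n.-tuple C) :=
  [set t | forall i, A i (tnth t i)].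

Lemma boxE n (A : 'I_n -> set C) :
  box A = \bigcap_(i in [set: 'I_n]) ((fun t : n.-tuple C => tnth t i) @^-1` A i).
Proof. by apply/seteqP; split=> [t h i _|t h i]; apply: h. Qed.

Lemma measurable_box n (A : 'I_n -> set C) :
  (forall i, measurable (A i)) -> measurable (box A).
Proof.
move=> mA; rewrite boxE; apply: fin_bigcap_measurable; first exact: finite_finset.
by move=> i _; rewrite -[X in measurable X]setTI; exact: measurable_tnth.
Qed.

Lemma box_recl n (A : 'I_n.+1 -> set C) :
  @tuple_cons n @^-1` box A = A ord0 `*` box (fun i => A (lift ord0 i)).
Proof.
apply/seteqP; split => -[z t] /=.
  by move=> h; split => [|i]; [exact: (h ord0)|rewrite -(tnth_tuple_consS z t)].
move=> [h0 h] i; case: (unliftP ord0 i) => [j|] -> //.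
by rewrite tnth_tuple_consS; exact: h.
Qed.

Lemma complex_gauss_box n (A : 'I_n -> set C) : (forall i, measurable (A i)) ->
  (complex_gauss n (box A) = \prod_(i < n) complex_normal (A i))%E.
Proof.
elim: n A => [|n ih] A mA.
  by rewrite big_ord0 /= diracE mem_set// => -[].
rewrite big_ord_recl -ih//.
rewrite -[LHS]/((complex_normal \x complex_gauss n)%E (@tuple_cons n @^-1` box A)).
by rewrite box_recl; apply: product_measure1E => //; exact: measurable_box.
Qed.

Definition boxes n : set (set (n.-tuple C)) :=
  [set box A | A in [set A | forall i, measurable (A i)]].

Lemma setI_closed_boxes n : setI_closed (@boxes n).
Proof.
move=> _ _ [A mA <-] [B mB <-]; exists (fun i => A i `&` B i).
  by move=> i /=; exact: measurableI.
apply/seteqP; split=> [t h|t [hA hB] i]; last by split.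
by split=> i; case: (h i).
Qed.

Lemma measurable_boxes n : @measurable _ (n.-tuple C) = <<s @boxes n >>.
Proof.
apply/seteqP; split; last first.
  apply: smallest_sub; first exact: sigma_algebra_measurable.
  by move=> _ [A mA <-]; exact: measurable_box.
rewrite /measurable/=; apply: smallest_sub; first exact: smallest_sigma_algebra.
move=> X; rewrite -bigcup_seq/= => -[i _ [B mB <-]].
apply: sub_sigma_algebra; exists (fun j => if j == i then B else setT).
  by move=> j /=; case: ifP.
rewrite setTI; apply/seteqP; split => [t /(_ i)|t Bt j] /=; first by rewrite eqxx.
by case: eqP => // ->.
Qed.

(** The boxes are a pi-system that generates the product sigma-algebra. This identifies the law of a
    tuple of independent [CN01] variables. *)
Lemma complex_gauss_unique n (m : {measure set (n.-tuple C) -> \bar R}) :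
  (forall A, (forall i, measurable (A i)) ->
     m (box A) = (\prod_(i < n) complex_normal (A i))%E) ->
  forall A, measurable A -> m A = complex_gauss n A.
Proof.
move=> mE; have bT : @boxes n setT.
  by exists (fun=> setT) => //; apply/seteqP; split.
apply: (measure_unique (@boxes n) (fun=> setT)) => //.
- exact: measurable_boxes.
- exact: setI_closed_boxes.
- by apply/seteqP; split=> // x _; exists 0.
- by move=> _ [A mA <-]; rewrite mE//; exact/esym/complex_gauss_box.
- move=> _; have -> : [set: n.-tuple C] = box (fun=> setT) by apply/seteqP; split.
  rewrite mE// big1 ?ltry// => i _; exact: probability_setT.
Qed.

End tuples.

(** * Change of measure between a translate and a dilate of a Gaussian vector *)

Section shift.
Context {R : realType}.
Local Notation C := R[i].

Definition energy n (z : n.-tuple C) : R := \sum_(i < n) sqnorm (tnth z i).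

(** The real part of the Hermitian product of [a] and [z]. With [energy z], it determines the
    likelihood ratio. *)
Definition correlation n (a : 'I_n -> C) (z : n.-tuple C) : R :=
  \sum_(i < n) (complex.Re (a i) * complex.Re (tnth z i) +
                complex.Im (a i) * complex.Im (tnth z i)).

Definition translate n (a : 'I_n -> C) (z : n.-tuple C) : n.-tuple C :=
  [tuple a i + tnth z i | i < n].

Definition dilate n (s : R) (z : n.-tuple C) : n.-tuple C :=
  [tuple s%:C%C * tnth z i | i < n].

Lemma measurable_energy n : measurable_fun [set: n.-tuple C] (@energy n).
Proof.
apply: measurable_sum => i; apply: measurable_sqnorm; exact: measurable_tnth.
Qed.

Lemma measurable_correlation n (a : 'I_n -> C) :
  measurable_fun [set: n.-tuple C] (correlation a).
Proof.
apply: measurable_sum => i; apply: measurable_funD; apply: measurable_funM => //.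
- exact: (measurableT_comp measurable_Re (@measurable_tnth _ _ _ _)).
- exact: (measurableT_comp measurable_Im (@measurable_tnth _ _ _ _)).
Qed.

Lemma measurable_translate n (a : 'I_n -> C) :
  measurable_fun [set: n.-tuple C] (translate a).
Proof.
apply: measurable_mktuple => i; apply: measurable_complexD => //.
exact: measurable_tnth.
Qed.

Lemma measurable_dilate n (s : R) :
  measurable_fun [set: n.-tuple C] (@dilate n s).
Proof.
apply: measurable_mktuple => i; apply: measurable_complexM => //.
exact: measurable_tnth.
Qed.

Lemma translate_cons n (a : 'I_n.+1 -> C) z (t : n.-tuple C) :
  translate a (tuple_cons (z, t)) =
  tuple_cons (a ord0 + z, translate (fun i => a (lift ord0 i)) t).
Proof.
apply: eq_from_tnth => i; rewrite tnth_mktuple.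
case: (unliftP ord0 i) => [j|] ->; last by rewrite !tnth_tuple_cons0.
by rewrite !tnth_tuple_consS tnth_mktuple.
Qed.

Lemma dilate_cons n s z (t : n.-tuple C) :
  dilate s (tuple_cons (z, t)) = tuple_cons (s%:C%C * z, dilate s t).
Proof.
apply: eq_from_tnth => i; rewrite tnth_mktuple.
case: (unliftP ord0 i) => [j|] ->; last by rewrite !tnth_tuple_cons0.
by rewrite !tnth_tuple_consS tnth_mktuple.
Qed.

Lemma energy_cons n z (t : n.-tuple C) :
  energy (tuple_cons (z, t)) = sqnorm z + energy t.
Proof.
rewrite /energy big_ord_recl tnth_tuple_cons0; congr (_ + _).
by apply: eq_bigr => i _; rewrite tnth_tuple_consS.
Qed.

Lemma correlation_cons n (a : 'I_n.+1 -> C) z (t : n.-tuple C) :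
  correlation a (tuple_cons (z, t)) =
  complex.Re (a ord0) * complex.Re z + complex.Im (a ord0) * complex.Im z +
  correlation (fun i => a (lift ord0 i)) t.
Proof.
rewrite /correlation big_ord_recl tnth_tuple_cons0; congr (_ + _).
by apply: eq_bigr => i _; rewrite tnth_tuple_consS.
Qed.

(* The exponent is [|z|^2 - |s z - a|^2], expanded. *)
Definition shift_weight n (s : R) (a : 'I_n -> C) (z : n.-tuple C) : R :=
  s ^+ 2 ^+ n * expR (energy z - (s ^+ 2 * energy z - s * correlation a z *+ 2 +
                                  \sum_(i < n) sqnorm (a i))).

Lemma measurable_shift_weight n s (a : 'I_n -> C) :
  measurable_fun [set: n.-tuple C] (shift_weight s a).
Proof.
apply: measurable_funM => //; apply: measurableT_comp => //.
apply: measurable_funB; first exact: measurable_energy.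
apply: measurable_funD => //; apply: measurable_funB.
  by apply: measurable_funM => //; exact: measurable_energy.
under eq_fun do rewrite -mulr_natr.
apply: measurable_funM => //; apply: measurable_funM => //.
exact: measurable_correlation.
Qed.

Lemma shift_weight_ge0 n s (a : 'I_n -> C) z : 0 <= shift_weight s a z.
Proof. by rewrite mulr_ge0 ?expR_ge0// exprn_ge0// sqr_ge0. Qed.

(** The weight is the likelihood ratio of the output [a + z] against the output [s z], as a function
    of the [z] that generates the latter. It is a product over the coordinates, so
    [complex_normal_shift] and an induction suffice. *)
Lemma complex_gauss_shift n (a : 'I_n -> C) (s : R)
    (F : n.-tuple C -> \bar R) : 0 < s ->
  measurable_fun [set: n.-tuple C] F -> (forall z, 0 <= F z)%E ->
  (\int[complex_gauss n]_z F (translate a z) =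
   \int[complex_gauss n]_z (F (dilate s z) * (shift_weight s a z)%:E))%E.
Proof.
move=> s0; elim: n a F => [|n ih] a F mF F0.
  rewrite !integral_complex_gauss0 /shift_weight /energy /correlation !big_ord0.
  rewrite expr0 !mulr0 mul0rn subrr addr0 subrr expR0 mulr1 mule1.
  by congr F; apply: eq_from_tnth => -[].
have mFT := measurableT_comp mF (measurable_translate a).
have mFD := measurableT_comp mF (@measurable_dilate n.+1 s).
rewrite !integral_complex_gaussS//; last 2 first.
- apply: emeasurable_funM => //; apply/measurable_EFinP.
  exact: measurable_shift_weight.
- by move=> z; rewrite mule_ge0// lee_fin shift_weight_ge0.
pose b i := a (lift ord0 i).
have mFc : measurable_fun [set: C * n.-tuple C] (F \o @tuple_cons _ n).
  exact: (measurableT_comp mF (@measurable_tuple_cons _ n)).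
have mFc1 z : measurable_fun [set: n.-tuple C] (fun t => F (tuple_cons (z, t))).
  exact: (measurableT_comp mFc (pair1_measurable z)).
transitivity (\int[complex_normal]_z \int[complex_gauss n]_t
    F (tuple_cons ((a ord0 + z)%R, translate b t)))%E.
  by apply: eq_integral => z _; apply: eq_integral => t _; rewrite translate_cons.
rewrite (@complex_normal_shift _ (a ord0) s (fun z => \int[complex_gauss n]_t
    F (tuple_cons (z, translate b t)))%E)//; last 2 first.
- apply: (measurable_fun_fubini_tonelli_F (m2 := complex_gauss n)
      (fun p => F (tuple_cons (p.1, translate b p.2)))) => //.
  apply: (measurableT_comp mFc); apply/measurable_fun_pair => //=.
  exact: (measurableT_comp (measurable_translate b) measurable_snd).
- by move=> z; exact: integral_ge0.
apply: eq_integral => z _; rewrite (ih b (fun t => F (tuple_cons (_, t))))//.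
rewrite -ge0_integralZr//; last 3 first.
- apply: emeasurable_funM.
    exact: (measurableT_comp (mFc1 _) (@measurable_dilate n s)).
  by apply/measurable_EFinP; exact: measurable_shift_weight.
- by move=> t _; rewrite mule_ge0// lee_fin shift_weight_ge0.
- by rewrite lee_fin mulr_ge0 ?expR_ge0 ?sqr_ge0.
apply: eq_integral => t _; rewrite -muleA -EFinM -dilate_cons.
congr (_ * _%:E)%E; rewrite /shift_weight energy_cons correlation_cons.
rewrite (big_ord_recl n) mulrACA -exprSr -expRD; congr (_ * expR _).
have -> : sqnorm (s%:C%C * z - a ord0) = s ^+ 2 * sqnorm z -
    s * (complex.Re (a ord0) * complex.Re z + complex.Im (a ord0) * complex.Im z) *+ 2 +
    sqnorm (a ord0).
  by case: (a ord0) z {mFT mFc1} => u v [x y]; rewrite /sqnorm/=; ring.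
by rewrite /b; ring.
Qed.

End shift.

(** * Spherical symmetry and the Neyman-Pearson inequality *)

Section spherical_symmetry.
Context {R : realType}.
Local Notation C := R[i].
Local Notation nu := (@half_normal R).
Local Notation T2 := (measurableTypeR R * measurableTypeR R)%type.

(* One more independent real coordinate [t] contributes [t ^+ 2] to the energy
   and [a * t] to the correlation with the channel input. *)
Definition gauss_op (a : R) (F : T2 -> \bar R) (p : T2) : \bar R :=
  (\int[nu]_t F (p.1 + t ^+ 2, p.2 + a * t)%R)%E.

Let measurable_gauss_integrand (a : R) (F : T2 -> \bar R) :
  measurable_fun [set: T2] F ->
  measurable_fun [set: T2 * measurableTypeR R]
    (fun q : T2 * measurableTypeR R => F (q.1.1 + q.2 ^+ 2, q.1.2 + a * q.2)).
Proof.
move=> mF; have m1 := measurable_fst : measurable_fun [set: T2 * measurableTypeR R] fst.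
have m2 := measurable_snd : measurable_fun [set: T2 * measurableTypeR R] snd.
apply: (measurable_fun_pairE mF).
  apply: measurable_funD; last exact: measurable_funX.
  exact: (measurableT_comp measurable_fst m1).
apply: measurable_funD; last exact: measurable_funM.
exact: (measurableT_comp measurable_snd m1).
Qed.

Lemma measurable_gauss_op a (F : T2 -> \bar R) : measurable_fun [set: T2] F ->
  (forall p, 0 <= F p)%E -> measurable_fun [set: T2] (gauss_op a F).
Proof.
move=> mF F0; apply: (measurable_fun_fubini_tonelli_F (m2 := nu)
    (fun q : T2 * measurableTypeR R => F (q.1.1 + q.2 ^+ 2, q.1.2 + a * q.2))) => //.
exact: measurable_gauss_integrand.
Qed.

Lemma gauss_op_ge0 a (F : T2 -> \bar R) : (forall p, 0 <= F p)%E ->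
  forall p, (0 <= gauss_op a F p)%E.
Proof. by move=> F0 p; apply: integral_ge0 => t _; exact: F0. Qed.

(** Two coordinates [x], [y] are rotated so that [a * x + b * y] becomes [r] times the first new
    coordinate; [x ^+ 2 + y ^+ 2] is unchanged, and the second new coordinate no longer enters the
    correlation. *)
Lemma gauss_op_rotation a b (F : T2 -> \bar R) : measurable_fun [set: T2] F ->
  (forall p, 0 <= F p)%E ->
  gauss_op a (gauss_op b F) = gauss_op (Num.sqrt (a ^+ 2 + b ^+ 2)) (gauss_op 0 F).
Proof.
move=> mF F0.
have ab0 : 0 <= a ^+ 2 + b ^+ 2 by rewrite addr_ge0 ?sqr_ge0.
move: (Num.sqrt _) (sqr_sqrtr ab0) => r r2.
(* The rotation has coefficients [a / r] and [b / r]; [r = 0] means [a = b = 0], where nothing has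
   to be rotated. *)
have [r0|r0] := eqVneq r 0.
  have ab : a ^+ 2 + b ^+ 2 == 0 by rewrite -r2 r0 expr0n.
  have /andP[/eqP a0 /eqP b0] : (a == 0) && (b == 0).
    by move: ab; rewrite paddr_eq0 ?sqr_ge0// !sqrf_eq0.
  by rewrite r0 a0 b0.
apply/funext => -[s l]; rewrite /gauss_op/=.
pose Phi (z : T2) := F (s + z.1 ^+ 2 + z.2 ^+ 2, l + r * z.1 + 0 * z.2).
have mPhi : measurable_fun [set: T2] Phi.
  apply: (measurable_fun_pairE mF).
    by apply: measurable_funD; [apply: measurable_funD|];
      rewrite ?measurable_cst//; apply: measurable_funX.
  apply: measurable_funD; last exact: measurable_funM.
  by apply: measurable_funD => //; exact: measurable_funM.
have pq : (a / r) ^+ 2 + (b / r) ^+ 2 = 1.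
  by rewrite !expr_div_n -mulrDl -r2 divff// sqrf_eq0.
rewrite -[RHS](half_normal_rotation pq mPhi (fun z => F0 _)).
apply: eq_integral => x _; apply: eq_integral => y _; rewrite /Phi/=.
congr (F (_, _)); last by field.
transitivity (s + ((a / r) ^+ 2 + (b / r) ^+ 2) * (x ^+ 2 + y ^+ 2)).
  by rewrite pq mul1r addrA.
by ring.
Qed.

Let Kfold (F : T2 -> \bar R) (l : seq R) := foldr gauss_op F l.

Let Kfold_measurable F l : measurable_fun [set: T2] F -> (forall p, 0 <= F p)%E ->
  measurable_fun [set: T2] (Kfold F l) /\ (forall p, 0 <= Kfold F l p)%E.
Proof.
move=> mF F0; elim: l => [|a l [mK K0]] //=.
by split; [exact: measurable_gauss_op|exact: gauss_op_ge0].
Qed.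

(** Rotations merge the coefficients from the right into one, equal to the norm of the list,
    followed by zeros. With two coefficients or more, rotations do all the work; a single one would
    call for the symmetry [t |-> - t] to become its absolute value. *)
Let Kfold_norm F a b l : measurable_fun [set: T2] F -> (forall p, 0 <= F p)%E ->
  Kfold F [:: a, b & l] =
  gauss_op (Num.sqrt (\sum_(x <- [:: a, b & l]) x ^+ 2))
    (Kfold F (nseq (size l).+1 0)).
Proof.
move=> mF F0; elim: l a b => [|c l ih] a b.
  by rewrite /= !big_cons big_nil addr0 gauss_op_rotation.
have [mK K0] := Kfold_measurable (nseq (size l).+1 0) mF F0.
have -> : Kfold F [:: a, b, c & l] = gauss_op a (Kfold F [:: b, c & l]) by [].
rewrite ih (gauss_op_rotation _ _ mK K0) sqr_sqrtr; last first.
  by rewrite sumr_ge0// => x _; exact: sqr_ge0.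
rewrite [in RHS]big_cons; reflexivity.
Qed.

Fixpoint coords n : ('I_n -> C) -> seq R :=
  match n with
  | 0 => fun=> [::]
  | k.+1 => fun a => [:: complex.Re (a ord0), complex.Im (a ord0) &
                         coords (fun i => a (lift ord0 i))]
  end.

Let size_coords n (a : 'I_n -> C) : size (coords a) = n.*2.
Proof. by elim: n a => //= n ih a; rewrite ih. Qed.

Let sum_coords n (a : 'I_n -> C) :
  \sum_(x <- coords a) x ^+ 2 = \sum_(i < n) sqnorm (a i).
Proof.
elim: n a => [|n ih] a; first by rewrite big_nil big_ord0.
by rewrite /= !big_cons big_ord_recl ih addrA.
Qed.

(** The offsets [s] and [l] accumulate the energy and the correlation of the coordinates already
    integrated; the induction needs them arbitrary. *)
Let integral_coords n (a : 'I_n -> C) (F : T2 -> \bar R) s l :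
  measurable_fun [set: T2] F -> (forall p, 0 <= F p)%E ->
  (\int[complex_gauss n]_z F (s + energy z, l + correlation a z)%R =
   Kfold F (coords a) (s, l))%E.
Proof.
move=> mF F0; elim: n a s l => [|n ih] a s l.
  by rewrite integral_complex_gauss0 /energy /correlation !big_ord0 !addr0.
have mI k (b : 'I_k -> C) s' l' : measurable_fun [set: k.-tuple C]
    (fun z => F (s' + energy z, l' + correlation b z)).
  apply: (measurable_fun_pairE mF); apply: measurable_funD => //.
  - exact: measurable_energy.
  - exact: measurable_correlation.
rewrite integral_complex_gaussS//.
pose b i := a (lift ord0 i).
have [mK K0] := Kfold_measurable (coords b) mF F0.
transitivity (\int[complex_normal]_z Kfold F (coords b) (s + sqnorm z,
    l + (complex.Re (a ord0) * complex.Re z + complex.Im (a ord0) * complex.Im z))%R)%E.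
  apply: eq_integral => z _; rewrite -ih; apply: eq_integral => t _.
  by rewrite energy_cons correlation_cons !addrA.
have mKf : measurable_fun [set: C] (fun z => Kfold F (coords b) (s + sqnorm z,
    l + (complex.Re (a ord0) * complex.Re z + complex.Im (a ord0) * complex.Im z))).
  apply: (measurable_fun_pairE mK); apply: measurable_funD => //.
    exact: measurable_sqnorm.
  by apply: measurable_funD; apply: measurable_funM => //;
    [exact: measurable_Re|exact: measurable_Im].
apply: etrans (integral_complex_normal mKf (fun z => K0 _)) _.
apply: eq_integral => x _; apply: eq_integral => y _ /=.
by rewrite /sqnorm/= !addrA.
Qed.

(** Each side is folded over its real coordinates, and by [Kfold_norm] the result depends on the
    vector only through its norm. No orthogonal matrix taking [a] to [b] has to be constructed. *)
Lemma complex_gauss_spherical n (a b : 'I_n -> C) (F : T2 -> \bar R) :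
  \sum_(i < n) sqnorm (a i) = \sum_(i < n) sqnorm (b i) ->
  measurable_fun [set: T2] F -> (forall p, 0 <= F p)%E ->
  (\int[complex_gauss n]_z F (energy z, correlation a z) =
   \int[complex_gauss n]_z F (energy z, correlation b z))%E.
Proof.
move=> ab mF F0.
have := integral_coords a 0 0 mF F0; have := integral_coords b 0 0 mF F0.
under eq_integral do rewrite !add0r.
move=> ->; under eq_integral do rewrite !add0r.
move=> ->; move: ab; rewrite -!sum_coords.
case: n a b => [|n] a b ab; first reflexivity.
rewrite /coords -/coords !(Kfold_norm _ _ _ mF F0) !size_coords.
by move: ab => /= ->.
Qed.

End spherical_symmetry.

Section neyman_pearson.
Context {R : realType}.
Local Notation C := R[i].
Local Notation T2 := (measurableTypeR R * measurableTypeR R)%type.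

(* The log-likelihood ratio of [Y = a + Z] against [Y = sqrt (1 + g) Z], where
   [|a|^2 = n g], as a function of [e = |Z|^2] and [r = Re <a, Z>]: [llr_S] when
   [Y = a + Z] and [llr_L] when [Y = sqrt (1 + g) Z]. *)
Definition llr_S (n : nat) (g e r : R) : R :=
  n%:R * ln (1 + g) + ((e + r *+ 2 + n%:R * g) / (1 + g) - e).

Definition llr_L (n : nat) (g e r : R) : R :=
  n%:R * ln (1 + g) + (e - ((1 + g) * e - Num.sqrt (1 + g) * r *+ 2 + n%:R * g)).

Lemma energy_dilate n s (z : n.-tuple C) : energy (dilate s z) = s ^+ 2 * energy z.
Proof.
rewrite /energy mulr_sumr; apply: eq_bigr => i _; rewrite tnth_mktuple.
by case: (tnth z i) => x y; rewrite /sqnorm/=; ring.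
Qed.

Lemma correlation_dilate n (a : 'I_n -> C) s (z : n.-tuple C) :
  correlation a (dilate s z) = s * correlation a z.
Proof.
rewrite /correlation mulr_sumr; apply: eq_bigr => i _; rewrite tnth_mktuple.
by case: (tnth z i) (a i) => x y [u v] /=; ring.
Qed.

Lemma energy_translate n (a : 'I_n -> C) (z : n.-tuple C) :
  energy (translate a z) =
  energy z + correlation a z *+ 2 + \sum_(i < n) sqnorm (a i).
Proof.
rewrite /energy /correlation -mulr_natr mulr_suml -!big_split/=.
apply: eq_bigr => i _; rewrite tnth_mktuple.
by case: (tnth z i) (a i) => x y [u v]; rewrite /sqnorm/=; ring.
Qed.

Lemma correlation_translate n (a : 'I_n -> C) (z : n.-tuple C) :
  correlation a (translate a z) = correlation a z + \sum_(i < n) sqnorm (a i).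
Proof.
rewrite /correlation -big_split/=.
apply: eq_bigr => i _; rewrite tnth_mktuple.
by case: (tnth z i) (a i) => x y [u v]; rewrite /sqnorm/=; ring.
Qed.

Lemma measurable_preimageT d d' (T : measurableType d) (T' : measurableType d')
    (f : T -> T') (A : set T') :
  measurable_fun [set: T] f -> measurable A -> measurable (f @^-1` A).
Proof. by move=> mf mA; rewrite -[X in measurable X]setTI; exact: mf. Qed.

Section fixed_gain.
Variables (n : nat) (g c : R) (a : 'I_n -> C).
Hypothesis g0 : 0 <= g.
Hypothesis ag : \sum_(i < n) sqnorm (a i) = n%:R * g.

Local Notation s := (Num.sqrt (1 + g)).
Local Notation gam := (complex_gauss n).

Let g1 : 0 < 1 + g. Proof. by rewrite ltr_wpDr. Qed.

Let s0 : 0 < s. Proof. by rewrite sqrtr_gt0. Qed.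

Let s2 : s ^+ 2 = 1 + g. Proof. by rewrite sqr_sqrtr// ltW. Qed.

Let S z := llr_S n g (energy z) (correlation a z).
Let L z := llr_L n g (energy z) (correlation a z).

Let weightE z : shift_weight s a z = expR (L z).
Proof.
rewrite /L /llr_L expRD /shift_weight s2 ag expRM_natl lnK ?posrE//.
Qed.

(** The Neyman-Pearson region in terms of the output [y]: the log-likelihood ratio [n ln (1 + g) +
    |y|^2 / (1 + g) - |y - a|^2], expanded with [|a|^2 = n g], exceeds [c]. Its preimages under the
    two channels are the events on [S] and on [L]. *)
Let D : set (n.-tuple C) := [set y | c < n%:R * ln (1 + g) +
  (energy y / (1 + g) - (energy y - correlation a y *+ 2 + n%:R * g))].

Let mL : measurable_fun [set: n.-tuple C] L.
Proof.
apply: measurable_funD => //; apply: measurable_funB; first exact: measurable_energy.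
apply: measurable_funD => //; apply: measurable_funB.
  by apply: measurable_funM => //; exact: measurable_energy.
under eq_fun do rewrite -mulr_natr.
by apply: measurable_funM => //; apply: measurable_funM => //; exact: measurable_correlation.
Qed.

Let mD : measurable D.
Proof.
pose f y := n%:R * ln (1 + g) +
  (energy y / (1 + g) - (energy y - correlation a y * 2 + n%:R * g)).
have mf : measurable_fun [set: n.-tuple C] f.
  apply: measurable_funD => //; apply: measurable_funB.
    by apply: measurable_funM => //; exact: measurable_energy.
  apply: measurable_funD => //; apply: measurable_funB; first exact: measurable_energy.
  by apply: measurable_funM => //; exact: measurable_correlation.
rewrite (_ : D = f @^-1` `]c, +oo[%classic).
  by apply: measurable_preimageT.
by apply/seteqP; split=> y; rewrite /D/= in_itv/= andbT /f mulr_natr.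
Qed.

Let D_translate : translate a @^-1` D = [set z | c < S z].
Proof.
apply/seteqP; split=> z; rewrite /D /S /llr_S /= energy_translate
  correlation_translate ag; congr (is_true (_ < _ + _));
  by field; rewrite gt_eqF.
Qed.

Let D_dilate : @dilate _ n s @^-1` D = [set z | c < L z].
Proof.
apply/seteqP; split=> z; rewrite /D /L /llr_L /= energy_dilate
  correlation_dilate s2; congr (is_true (_ < _ + _));
  by field; rewrite gt_eqF.
Qed.

Let gauss_translate (B : set (n.-tuple C)) : measurable B ->
  (gam (translate a @^-1` B) =
   \int[gam]_z ((\1_(@dilate _ n s @^-1` B) z)%:E * (expR (L z))%:E))%E.
Proof.
move=> mB.
have mtB : measurable (translate a @^-1` B).
  by apply: measurable_preimageT mB; exact: measurable_translate.
transitivity (\int[gam]_z (\1_B (translate a z))%:E)%E.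
  by rewrite (integral_indic gam measurableT mtB) setIT.
have mB1 : measurable_fun [set: n.-tuple C] (fun z => (\1_B z)%:E : \bar R).
  exact/measurable_EFinP.
have B0 z : (0 <= (\1_B z)%:E :> \bar R)%E by rewrite lee_fin.
apply: etrans (complex_gauss_shift a s0 mB1 B0) _.
by apply: eq_integral => z _; rewrite weightE.
Qed.

(** Once [gauss_translate] has written the true channel in terms of the reference one, all terms are
    integrals over the same [z], and the integrands compare pointwise:
    [(1_D - 1_B) (e^L - e^c) >= 0] at [dilate s z], because this point is in [D] exactly when
    [c < L z]. *)
Lemma neyman_pearson_gauss (B : set (n.-tuple C)) : measurable B ->
  (gam (translate a @^-1` B) + (expR c)%:E * gam [set z | (c < L z)%R] <=
   gam [set z | (c < S z)%R] + (expR c)%:E * gam (@dilate _ n s @^-1` B))%E.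
Proof.
move=> mB; rewrite -D_translate -D_dilate !gauss_translate//.
have mdl (A : set (n.-tuple C)) : measurable A -> measurable (@dilate _ n s @^-1` A).
  by move=> mA; apply: measurable_preimageT mA; exact: measurable_dilate.
have gE (A : set (n.-tuple C)) : measurable A -> ((expR c)%:E * gam A =
    \int[gam]_z ((expR c)%:E * (\1_A z)%:E))%E.
  move=> mA; have mA1 : measurable_fun [set: n.-tuple C] (fun z => (\1_A z)%:E : \bar R).
    exact/measurable_EFinP.
  rewrite (ge0_integralZl gam measurableT mA1) ?lee_fin ?expR_ge0//.
  by rewrite (integral_indic gam measurableT mA) setIT.
have m1 (A : set (n.-tuple C)) : measurable A ->
    measurable_fun [set: n.-tuple C] (fun z => (\1_A z)%:E * (expR (L z))%:E)%E.
  move=> mA; apply: emeasurable_funM; apply/measurable_EFinP => //.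
  exact: measurableT_comp.
have m2 (A : set (n.-tuple C)) : measurable A ->
    measurable_fun [set: n.-tuple C] (fun z => (expR c)%:E * (\1_A z)%:E)%E.
  by move=> mA; apply: emeasurable_funM => //; apply/measurable_EFinP.
have p1 (A : set (n.-tuple C)) z : (0 <= (\1_A z)%:E * (expR (L z))%:E)%E.
  by rewrite mule_ge0 ?lee_fin ?expR_ge0.
have p2 (A : set (n.-tuple C)) z : (0 <= (expR c)%:E * (\1_A z)%:E)%E.
  by rewrite mule_ge0 ?lee_fin ?expR_ge0.
rewrite !gE; [|exact: mdl..].
rewrite -!ge0_integralD//; try by [exact: m1 (mdl _ _)|exact: m2 (mdl _ _)].
apply: ge0_le_integral => //.
- by move=> z _; rewrite adde_ge0.
- by apply: emeasurable_funD; [exact: m1 (mdl _ _)|exact: m2 (mdl _ _)].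
- by apply: emeasurable_funD; [exact: m1 (mdl _ _)|exact: m2 (mdl _ _)].
move=> z _; rewrite -!EFinM -!EFinD lee_fin D_dilate !indicE.
have [zL|zL] := ltP c (L z).
  have -> : z \in [set z | c < L z] by rewrite inE.
  case: (_ \in _) => /=; rewrite ?mul1r ?mulr1 ?mul0r ?mulr0 ?addr0 ?add0r//.
  by rewrite ler_expR ltW.
have -> : z \in [set z | c < L z] = false.
  by apply/negbTE; rewrite notin_setE/=; apply/negP; rewrite -leNgt.
by case: (_ \in _) => /=; rewrite ?mul1r ?mulr1 ?mul0r ?mulr0 ?addr0 ?add0r// ler_expR.
Qed.

(** By [gauss_translate], the probability of [c < S] is the integral of [e^L] over the event
    [c < L], here a null set. *)
Lemma llr_abs_cont : gam [set z | c < L z] = 0%E -> gam [set z | c < S z] = 0%E.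
Proof.
move=> L0; rewrite -D_translate gauss_translate// D_dilate.
have mLc : measurable [set z | c < L z].
  rewrite -D_dilate; apply: measurable_preimageT mD; exact: measurable_dilate.
transitivity (\int[gam]_(z in [set z | (c < L z)%R]) (expR (L z))%:E)%E.
  rewrite [RHS]integral_mkcond; apply: eq_integral => z _.
  by rewrite patchE indicE; case: ifPn => _; rewrite ?mul1e ?mul0e.
apply: null_set_integral => //; apply/measurable_funTS/measurable_EFinP.
exact: measurableT_comp.
Qed.

End fixed_gain.

End neyman_pearson.

(** * The converse and the absence of atoms for a fixed fading *)

Section fixed_fading.
Context {R : realType}.
Local Notation C := R[i].
Local Notation nu := (@half_normal R).
Local Notation T2 := (measurableTypeR R * measurableTypeR R)%type.

(** The representative of the sphere of squared norm [n g] whose coordinates are all equal: with it,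
    [llr_S] and [llr_L] become the sums that define [S_n] and [L_n]. *)
Definition const_input n (g : R) : 'I_n -> C := fun=> (Num.sqrt g)%:C%C.

Arguments const_input n g : clear implicits.

Lemma sqnorm_real (x : R) : sqnorm (x%:C%C) = x ^+ 2.
Proof. by rewrite /sqnorm/= expr0n addr0. Qed.

Lemma sqnormM (x y : C) : sqnorm (x * y) = sqnorm x * sqnorm y.
Proof. by case: x y => a b [u v]; rewrite /sqnorm/=; ring. Qed.

Lemma sum_const_input n g : 0 <= g ->
  \sum_(i < n) sqnorm (const_input n g i) = n%:R * g.
Proof.
move=> g0; rewrite (eq_bigr (fun=> g)) => [|i _]; last first.
  by rewrite sqnorm_real sqr_sqrtr.
by rewrite sumr_const card_ord mulr_natl.
Qed.

Lemma measurable_llr_S d (T : measurableType d) n (g e r : T -> R) :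
  measurable_fun [set: T] g -> (forall t, 0 <= g t) ->
  measurable_fun [set: T] e -> measurable_fun [set: T] r ->
  measurable_fun [set: T] (fun t => llr_S n (g t) (e t) (r t)).
Proof.
move=> mg g0 me mr; rewrite /llr_S; under eq_fun => t do rewrite -(mulr_natr (r t)).
have m1 : measurable_fun [set: T] (fun t => 1 + g t) by exact: measurable_funD.
apply: measurable_funD.
  by apply: measurable_funM => //; exact: (measurableT_comp (@measurable_ln R)).
apply: measurable_funB => //; apply: measurable_funM.
  apply: measurable_funD; last exact: measurable_funM.
  by apply: measurable_funD => //; exact: measurable_funM.
under eq_fun do rewrite -powR_inv1 ?addr_ge0//.
exact: (measurableT_comp (measurable_powR _)).
Qed.

Lemma measurable_llr_L d (T : measurableType d) n (g e r : T -> R) :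
  measurable_fun [set: T] g ->
  measurable_fun [set: T] e -> measurable_fun [set: T] r ->
  measurable_fun [set: T] (fun t => llr_L n (g t) (e t) (r t)).
Proof.
move=> mg me mr; rewrite /llr_L; under eq_fun => t do rewrite -(mulr_natr (Num.sqrt _ * r t)).
have m1 : measurable_fun [set: T] (fun t => 1 + g t) by exact: measurable_funD.
apply: measurable_funD.
  by apply: measurable_funM => //; exact: (measurableT_comp (@measurable_ln R)).
apply: measurable_funB => //; apply: measurable_funD; last exact: measurable_funM.
apply: measurable_funB; first exact: measurable_funM.
apply: measurable_funM => //; apply: measurable_funM => //.
exact: (measurableT_comp (continuous_measurable_fun (@sqrt_continuous R))).
Qed.

Lemma spherical_set n (a b : 'I_n -> C) (c : R) (f : R -> R -> R) :
  \sum_(i < n) sqnorm (a i) = \sum_(i < n) sqnorm (b i) ->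
  measurable_fun [set: T2] (fun p : T2 => f p.1 p.2) ->
  complex_gauss n [set z | c < f (energy z) (correlation a z)] =
  complex_gauss n [set z | c < f (energy z) (correlation b z)].
Proof.
move=> ab mf; pose A : set T2 := [set p | c < f p.1 p.2].
have mA : measurable A.
  rewrite (_ : A = (fun p : T2 => f p.1 p.2) @^-1` `]c, +oo[%classic).
    exact: measurable_preimageT.
  by apply/seteqP; split=> p; rewrite /A/= in_itv/= andbT.
have mA1 : measurable_fun [set: T2] (fun p => (\1_A p)%:E : \bar R).
  exact/measurable_EFinP.
have A0 p : (0 <= (\1_A p)%:E :> \bar R)%E by rewrite lee_fin.
have E (d : 'I_n -> C) : (complex_gauss n [set z | (c < f (energy z) (correlation d z))%R] =
    \int[complex_gauss n]_z (\1_A (energy z, correlation d z))%:E)%E.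
  have mAd : measurable [set z | c < f (energy z) (correlation d z)].
    apply: (measurable_preimageT (f := fun z => (energy z, correlation d z) : T2)) mA.
    apply/measurable_fun_pair => /=.
    - exact: measurable_energy.
    - exact: measurable_correlation.
  apply/esym; apply: etrans (integral_indic (complex_gauss n) measurableT mAd) _.
  by rewrite setIT.
rewrite !E; exact: (complex_gauss_spherical ab mA1 A0).
Qed.

(* The code of blocklength [m] is extended by one symbol that brings the power of
   each codeword to exactly [(m + 1) P]; the test ignores that symbol. *)
Lemma converse_fixed_fading m (P c : R) (h : C) (x : 'I_m -> C)
    (T : set (m.-tuple C)) (g := P * sqnorm h) (b := const_input m.+1 g) :
  0 <= P -> \sum_(i < m) sqnorm (x i) <= m%:R * P -> measurable T ->
  (complex_gauss m (translate (fun i => h * x i)%R @^-1` T) +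
   (expR c)%:E * complex_gauss m.+1
     [set z | (c < llr_L m.+1 g (energy z) (correlation b z))%R] <=
   complex_gauss m.+1
     [set z | (c < llr_S m.+1 g (energy z) (correlation b z))%R] +
   (expR c)%:E * complex_gauss m (dilate (Num.sqrt (1 + g)%R) @^-1` T))%E.
Proof.
move=> P0 xP mT; have g0 : 0 <= g by rewrite mulr_ge0 ?sqnorm_ge0.
(* The completing symbol carries the missing power, nonnegative since the codeword uses at most
   [m P]. It sits at index 0, where [behead] discards it. *)
pose x0 : C := (Num.sqrt (m.+1%:R * P - \sum_(i < m) sqnorm (x i)))%:C%C.
pose a (i : 'I_m.+1) := h * oapp x x0 (unlift ord0 i).
have aS i : a (lift ord0 i) = h * x i by rewrite /a liftK.
have ag : \sum_(i < m.+1) sqnorm (a i) = m.+1%:R * g.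
  rewrite big_ord_recl; under eq_bigr do rewrite aS sqnormM.
  rewrite -mulr_sumr /a unlift_none /= sqnormM sqnorm_real sqr_sqrtr.
    by rewrite -mulrDr subrK /g; ring.
  by rewrite subr_ge0 (le_trans xP)// ler_wpM2r// ler_nat.
have bg : \sum_(i < m.+1) sqnorm (b i) = m.+1%:R * g by exact: sum_const_input.
have ab : \sum_(i < m.+1) sqnorm (a i) = \sum_(i < m.+1) sqnorm (b i) by rewrite ag bg.
pose B : set (m.+1.-tuple C) := [set t : m.+1.-tuple C | T [tuple of behead t]].
have mB : measurable B.
  apply: (measurable_preimageT (f := fun t : m.+1.-tuple C => [tuple of behead t])) mT.
  exact: measurable_behead.
have BE z (t : m.-tuple C) : B (tuple_cons (z, t)) = T t.
  by rewrite /B/=; congr T; apply/val_inj.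
(* An event that ignores coordinate 0 has the same probability in dimension [m.+1] as in dimension
   [m]. *)
have gS (X : set (m.+1.-tuple C)) (Y : set (m.-tuple C)) : measurable Y ->
    (forall z t, X (tuple_cons (z, t)) <-> Y t) ->
    complex_gauss m.+1 X = complex_gauss m Y.
  move=> mY XY.
  rewrite -[LHS]/((complex_normal \x complex_gauss m)%E (@tuple_cons _ m @^-1` X)).
  have -> : @tuple_cons _ m @^-1` X = setT `*` Y.
    by apply/seteqP; split => -[z t] /=; rewrite XY; [|case].
  apply: etrans (product_measure1E _ _ measurableT mY) _.
  rewrite -[RHS]mul1e; congr (_ * _)%E; exact: (probability_setT complex_normal).
rewrite -(gS (translate a @^-1` B)); last 2 first.
- by apply: measurable_preimageT mT; exact: measurable_translate.
- move=> z t; rewrite -[X in X <-> _]/(B (translate a (tuple_cons (z, t)))).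
  rewrite translate_cons BE.
  by rewrite (_ : (fun i => a (lift ord0 i)) = (fun i => h * x i))//; apply/funext.
rewrite -(gS (dilate (Num.sqrt (1 + g)) @^-1` B)); last 2 first.
- by apply: measurable_preimageT mT; exact: measurable_dilate.
- move=> z t; rewrite -[X in X <-> _]/(B (dilate _ (tuple_cons (z, t)))).
  by rewrite dilate_cons BE.
rewrite -(spherical_set c ab (f := llr_L m.+1 g)); last first.
  exact: (@measurable_llr_L _ T2 m.+1 (fun=> g) fst snd).
rewrite -(spherical_set c ab (f := llr_S m.+1 g)); last first.
  exact: (@measurable_llr_S _ T2 m.+1 (fun=> g) fst snd).
exact: neyman_pearson_gauss.
Qed.

Lemma llr_const_abs_cont n (g c : R) (b := const_input n g) : 0 <= g ->
  complex_gauss n [set z | c < llr_L n g (energy z) (correlation b z)] = 0%E ->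
  complex_gauss n [set z | c < llr_S n g (energy z) (correlation b z)] = 0%E.
Proof. by move=> g0; apply: llr_abs_cont => //; exact: sum_const_input. Qed.

Lemma half_normal_quadratic (p q r : R) : p != 0 ->
  nu [set x | p * x ^+ 2 + q * x + r = 0] = 0%E.
Proof.
move=> p0; set A := [set x | _].
have fA : finite_set A.
  have [->//|/set0P[x0 /= Ax0]] := eqVneq A set0.
  (* The two roots sum to [- q / p], so one root [x0] determines the other. *)
  apply: (@sub_finite_set _ _ [set x0; - q / p - x0]) => // x /= Ax.
  have : (x - x0) * (x - (- q / p - x0)) = 0.
    have -> : (x - x0) * (x - (- q / p - x0)) =
      ((p * x ^+ 2 + q * x + r) - (p * x0 ^+ 2 + q * x0 + r)) / p by field.
    by rewrite Ax Ax0 subrr mul0r.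
  by move/eqP; rewrite mulf_eq0 !subr_eq0 => /orP[] /eqP; [left|right].
have cA : countable A by exact: finite_set_countable.
have mA : @measurable _ (measurableTypeR R) A by exact: countable_measurable.
apply: null_set_integral => //; last exact: countable_lebesgue_measure0.
by apply/measurable_funTS/measurable_EFinP; exact: measurable_normal_pdf.
Qed.

Lemma llr_L_atomless m (g c : R) (b := const_input m.+1 g) : 0 < g ->
  complex_gauss m.+1 [set z | llr_L m.+1 g (energy z) (correlation b z) = c] = 0%E.
Proof.
move=> g0.
pose f (z : m.+1.-tuple C) := llr_L m.+1 g (energy z) (correlation b z).
have mf : measurable_fun [set: m.+1.-tuple C] f.
  apply: (@measurable_llr_L _ _ m.+1 (fun=> g)) => //.
  - exact: measurable_energy.
  - exact: measurable_correlation.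
have mA : measurable [set z | f z = c].
  by apply: (measurable_preimageT mf (A := [set c])).
have mA1 : measurable_fun [set: m.+1.-tuple C] (fun z => (\1_[set z | f z = c] z)%:E : \bar R).
  exact/measurable_EFinP.
have A0 z : (0 <= (\1_[set z | f z = c] z)%:E :> \bar R)%E by rewrite lee_fin.
transitivity (\int[complex_gauss m.+1]_z (\1_[set z | f z = c] z)%:E)%E.
  by rewrite (integral_indic (complex_gauss m.+1) measurableT mA) setIT.
rewrite integral_complex_gaussS//.
have mAc := measurableT_comp mA1 (@measurable_tuple_cons R m).
(* This exchange of integrals, and the later one between [x] and [y], bring the real part of the
   first coordinate innermost, all other coordinates being fixed. *)
rewrite (fubini_tonelli (m1 := complex_normal) (m2 := complex_gauss m)
  ((fun z => (\1_[set z | f z = c] z)%:E) \o @tuple_cons R m))//; last by move=> x; exact: A0.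
apply: integral0_eq => t _.
have mAt : measurable_fun [set: C]
    (fun z => (\1_[set z | f z = c] (tuple_cons (z, t)))%:E : \bar R).
  exact: (measurableT_comp mAc (pair2_measurable t)).
rewrite /= integral_complex_normal//.
have mAp : measurable_fun [set: T2]
    (fun p : T2 => (\1_[set z | f z = c] (tuple_cons ((p.1 +i* p.2)%C, t)))%:E : \bar R).
  exact: (measurableT_comp mAt (@measurable_complex_of_pair R)).
rewrite (fubini_tonelli (fun p : T2 => (\1_[set z | f z = c] (tuple_cons ((p.1 +i* p.2)%C, t)))%:E))//=.
apply: integral0_eq => y _.
pose s := Num.sqrt (1 + g).
pose r := m.+1%:R * ln (1 + g) + (y ^+ 2 + energy t) -
  ((1 + g) * (y ^+ 2 + energy t) -
    s * correlation (fun i => b (lift ord0 i)) t *+ 2 + m.+1%:R * g) - c.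
(* The energy enters [llr_L] with coefficient [1 - (1 + g)], hence the leading coefficient [- g],
   nonzero by hypothesis. *)
have fE x : f (tuple_cons ((x +i* y)%C, t)) - c = - g * x ^+ 2 + (s * Num.sqrt g *+ 2) * x + r.
  rewrite /f /llr_L energy_cons correlation_cons /r /sqnorm /=.
  by rewrite -/s mul0r; ring.
have mQ : @measurable _ (measurableTypeR R) [set x | f (tuple_cons ((x +i* y)%C, t)) = c].
  apply: (measurable_preimageT (f := fun x : measurableTypeR R => tuple_cons ((x +i* y)%C, t))) mA.
  apply: (measurableT_comp (@measurable_tuple_cons R m)); apply/measurable_fun_pair => //.
  by apply: measurable_complex; [exact: measurable_id|exact: measurable_cst].
rewrite -[LHS]/(\int[nu]_x (\1_[set x | f (tuple_cons ((x +i* y)%C, t)) = c] x)%:E)%E.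
rewrite (integral_indic nu measurableT mQ) setIT.
rewrite (_ : [set x | _] = [set x | - g * x ^+ 2 + (s * Num.sqrt g *+ 2) * x + r = 0]).
  by apply: half_normal_quadratic; rewrite oppr_eq0 gt_eqF.
apply/seteqP; split=> x /=; rewrite -fE; first by move=> ->; rewrite subrr.
by move/eqP; rewrite subr_eq0 => /eqP.
Qed.

End fixed_fading.

Arguments const_input {R} n g.

(** * Independence *)

Section independence_theory.
Context d (Omega : measurableType d) (R : realType) (Pr : probability Omega R).

Lemma mutual_independence_seq (I : choiceType) (F : I -> set (set Omega))
    (s : seq I) (A : I -> set Omega) :
  mutual_independence Pr F -> uniq s -> (forall i, i \in s -> F i (A i)) ->
  Pr (\bigcap_(i in [set` s]) A i) = (\prod_(i <- s) Pr (A i))%E.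
Proof.
move=> indF us FA; have := @indF (seq_fset tt s) A.
have -> : [set` seq_fset tt s] = [set` s].
  by apply/seteqP; split=> i; rewrite /mkset/=; rewrite (seq_fsetE tt s i).
move=> -> => [|i]; last by rewrite seq_fsetE; exact: FA.
by apply: perm_big; rewrite (perm_trans (seq_fset_perm _ _))// undup_id.
Qed.

Lemma mutual_independence_inj (I I' : choiceType) (f : I' -> I)
    (F : I -> set (set Omega)) : injective f ->
  mutual_independence Pr F -> mutual_independence Pr (fun i => F (f i)).
Proof.
move=> injf indF J A FA.
(* The family [A], transported along [f] and extended by [setT]; injectivity makes the chosen
   preimage the right one. *)
pose A' i := if pselect (exists2 x, x \in J & f x = i) is left e
             then A (s2val (cid2 e)) else setT.
have A'E x : x \in J -> A' (f x) = A x.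
  move=> xJ; rewrite /A'; case: pselect => [e|[]]; last by exists x.
  by case: (cid2 e) => y /= _ /injf ->.
have := @mutual_independence_seq _ F [seq f x | x <- J] A' indF.
rewrite map_inj_uniq// fset_uniq big_map => /(_ erefl) E.
transitivity (Pr (\bigcap_(i in [set` [seq f x | x <- J]]) A' i)).
  congr (Pr _); apply/seteqP; split => o h i /=.
    by move=> /mapP[x xJ ->]; rewrite A'E//; exact: h.
  move=> iJ; have := h (f i); rewrite A'E//; apply; exact: map_f.
rewrite E => [|_ /mapP[x xJ ->]]; last by rewrite A'E//; exact: FA.
by rewrite big_seq [RHS]big_seq; apply: eq_bigr => x xJ; rewrite A'E.
Qed.

(** The finite measures [A |-> Pr (A and E)] and [A |-> Pr E * Pr A] agree on a pi-system containing
    the whole space. *)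
Lemma independence_generated (G : set (set Omega)) (E : set Omega) :
  measurable E -> G `<=` measurable -> setI_closed G -> G setT ->
  (forall A, G A -> Pr (E `&` A) = Pr E * Pr A)%E ->
  forall A, <<s G >> A -> (Pr (E `&` A) = Pr E * Pr A)%E.
Proof.
move=> mE mG GI GT EG A sA.
have PrE0 : 0 <= fine (Pr E) by rewrite fine_ge0.
pose m1 := mrestr Pr mE; pose m2 := mscale (NngNum PrE0) Pr.
have PrEE : ((fine (Pr E))%:E = Pr E)%E by rewrite fineK// fin_num_measure.
have : m1 A = m2 A.
  apply: (g_sigma_algebra_measure_unique G mG (fun=> setT)) => //.
  - by apply/seteqP; split=> // x _; exists 0.
  - move=> B GB; rewrite -[LHS]/(Pr (B `&` E)) -[RHS]/((fine (Pr E))%:E * Pr B)%E.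
    by rewrite setIC PrEE; exact: EG.
  - move=> _; rewrite -[ltLHS]/(Pr (setT `&` E)).
    by rewrite setTI (le_lt_trans (probability_le1 _ _))// ltry.
rewrite -[LHS]/(Pr (A `&` E)) -[RHS]/((fine (Pr E))%:E * Pr A)%E.
by rewrite setIC PrEE.
Qed.

Section blocks.
Variables (I : choiceType) (F : I -> set (set Omega)).
Hypothesis indF : mutual_independence Pr F.
Hypothesis mF : forall i, F i `<=` measurable.
Hypothesis FI : forall i, setI_closed (F i).

(** The pi-system behind the sigma-algebra of a block of indices: mutual independence speaks of
    these finite intersections, and the rest follows by uniqueness of measures. *)
Definition cylinders (D : set I) : set (set Omega) :=
  [set X | exists (s : seq I) (A : I -> set Omega), [/\ uniq s,
     forall i, i \in s -> D i /\ F i (A i) & X = \bigcap_(i in [set` s]) A i]].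

Let measurable_cylinders D : cylinders D `<=` measurable.
Proof.
move=> _ [s [A [us DA ->]]]; apply: fin_bigcap_measurable.
  exact: finite_seq.
by move=> i /DA[_ FA]; exact: mF FA.
Qed.

Let cylindersT D : cylinders D setT.
Proof.
by exists [::], (fun=> setT); split => //; apply/seteqP; split.
Qed.

Let setI_closed_cylinders D : setI_closed (cylinders D).
Proof.
move=> _ _ [s [A [us DA ->]]] [t [B [ut DB ->]]].
exists (undup (s ++ t)), (fun i => (if i \in s then A i else setT) `&`
                                   (if i \in t then B i else setT)).
split; first exact: undup_uniq.
  move=> i; rewrite mem_undup mem_cat.
  have [iS|_] := boolP (i \in s); have [it|_] := boolP (i \in t) => //= _.
  - by have [[Di FA] [_ FB]] := (DA _ iS, DB _ it); split => //; exact: FI.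
  - by rewrite setIT; exact: DA.
  - by rewrite setTI; exact: DB.
apply/seteqP; split => [w [hA hB] i _ | w h].
  by split; case: ifPn => // ii; [exact: hA|exact: hB].
split=> i /= ii; have := h i; rewrite /= mem_undup mem_cat ii ?orbT => /(_ erefl)[].
  by [].
by [].
Qed.

Let sub_cylinders D : <<s \bigcup_(i in D) F i >> `<=` <<s cylinders D >>.
Proof.
apply: smallest_sub; first exact: smallest_sigma_algebra.
move=> A [i Di FA]; apply: sub_sigma_algebra.
exists [:: i], (fun=> A); split => //.
  by move=> j; rewrite inE => /eqP ->.
by apply/seteqP; split=> [w Aw j _ //|w]; apply => /=; exact: mem_head.
Qed.

Let independent_cylinders D1 D2 A B : D1 `&` D2 = set0 ->
  cylinders D1 A -> cylinders D2 B -> (Pr (A `&` B) = Pr A * Pr B)%E.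
Proof.
move=> D12 [s [A' [us DA ->]]] [t [B' [ut DB ->]]].
have disj i : i \in s -> i \in t -> False.
  move=> /DA[D1i _] /DB[D2i _].
  by have : (D1 `&` D2) i by []; rewrite D12.
pose C i := if i \in s then A' i else B' i.
have Ct i : i \in t -> C i = B' i.
  by move=> it; rewrite /C; case: ifPn => // /disj /(_ it).
have Cs i : i \in s -> C i = A' i by move=> iS; rewrite /C iS.
have ust : uniq (s ++ t).
  rewrite cat_uniq us ut andbT /=; apply/hasPn => i it.
  by apply/negP => /disj /(_ it).
transitivity (Pr (\bigcap_(i in [set` s ++ t]) C i)).
  congr (Pr _); apply/seteqP; split => [w [hA hB] i /=|w h].
    rewrite mem_cat => /orP[iS|it]; first by rewrite Cs//; exact: hA.
    by rewrite Ct//; exact: hB.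
  split=> i /= ii; have := h i; rewrite /= mem_cat ii ?orbT => /(_ erefl).
    by rewrite Cs.
  by rewrite Ct.
rewrite (mutual_independence_seq indF)// => [|i]; last first.
  rewrite mem_cat => /orP[iS|it].
    by rewrite Cs//; have [] := DA i iS.
  by rewrite Ct//; have [] := DB i it.
rewrite big_cat/= (mutual_independence_seq indF us) => [|i /DA[]//].
rewrite (mutual_independence_seq indF ut) => [|i /DB[]//].
congr (_ * _)%E; rewrite big_seq [RHS]big_seq; apply: eq_bigr => i ii.
  by rewrite Cs.
by rewrite Ct.
Qed.

(** [independence_generated] is used twice: first [B] passes from cylinders to the generated
    sigma-algebra with [A] a cylinder, then [A] does so with [B] arbitrary. *)
Lemma independent_blocks (D1 D2 : set I) A B : D1 `&` D2 = set0 ->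
  <<s \bigcup_(i in D1) F i >> A -> <<s \bigcup_(i in D2) F i >> B ->
  (Pr (A `&` B) = Pr A * Pr B)%E.
Proof.
move=> D12 /sub_cylinders sA /sub_cylinders sB.
have mB : measurable B.
  by apply: (smallest_sub _ (@measurable_cylinders D2) sB); exact: sigma_algebra_measurable.
have step C : cylinders D1 C -> (Pr (C `&` B) = Pr C * Pr B)%E.
  move=> cC; apply: (independence_generated (measurable_cylinders cC)
    (@measurable_cylinders D2) (@setI_closed_cylinders D2) (cylindersT D2) _ sB).
  by move=> E cE; exact: (independent_cylinders D12 cC cE).
rewrite setIC muleC; apply: (independence_generated mB
  (@measurable_cylinders D1) (@setI_closed_cylinders D1) (cylindersT D1) _ sA).
by move=> C cC; rewrite setIC step// muleC.
Qed.

End blocks.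

Lemma sigma_rv_measurable d' (T : measurableType d') (X : Omega -> T) :
  measurable_fun [set: Omega] X -> sigma_rv X `<=` measurable.
Proof. by move=> mX _ [B mB <-]; exact: mX. Qed.

Lemma setI_closed_sigma_rv d' (T : measurableType d') (X : Omega -> T) :
  setI_closed (sigma_rv X).
Proof.
move=> _ _ [A mA <-] [B mB <-]; exists (A `&` B); first exact: measurableI.
by rewrite !setTI preimage_setI.
Qed.

Lemma setI_closed_sigma_fin (T : finType) (X : Omega -> T) :
  setI_closed (sigma_fin X).
Proof.
move=> _ _ [A _ <-] [B _ <-]; exists (A `&` B) => //.
by rewrite !setTI preimage_setI.
Qed.

Lemma sigma_fin_measurable (T : finType) (X : Omega -> T) :
  (forall x, measurable (X @^-1` [set x])) -> sigma_fin X `<=` measurable.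
Proof.
move=> mX _ [B _ <-]; rewrite setTI.
have -> : X @^-1` B = \bigcup_(x in B) (X @^-1` [set x]).
  by apply/seteqP; split=> [w Bw|w [x Bx /= ->]//]; exists (X w).
by apply: fin_bigcup_measurable => //; exact: finite_finset.
Qed.

(** Measurability with respect to a sub-sigma-algebra is expressed by retyping the sample space as
    [g_sigma_algebraType G], so that closure lemmas about measurable functions apply to it
    directly. *)
Lemma measurable_sub_sigma (G : set (set Omega)) d' (T : measurableType d')
    (X : Omega -> T) : sigma_rv X `<=` G ->
  measurable_fun [set: g_sigma_algebraType G] (X : g_sigma_algebraType G -> T).
Proof.
by move=> XG _ B mB; apply: sub_sigma_algebra; apply: XG; exists B.
Qed.

Lemma law_pair d1 d2 (T1 : measurableType d1) (T2 : measurableType d2)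
    (mu1 : {sigma_finite_measure set T1 -> \bar R})
    (mu2 : {sigma_finite_measure set T2 -> \bar R})
    (X : Omega -> T1) (Y : Omega -> T2) :
  measurable_fun [set: Omega] X -> measurable_fun [set: Omega] Y ->
  (forall A B, measurable A -> measurable B ->
     Pr (X @^-1` A `&` Y @^-1` B) = (mu1 A * mu2 B)%E) ->
  forall S, measurable S -> Pr ((fun o => (X o, Y o)) @^-1` S) = (mu1 \x mu2)%E S.
Proof.
move=> mX mY XY S mS.
have mXY : measurable_fun [set: Omega] (fun o => (X o, Y o)) by exact: measurable_fun_pair.
pose mXYmix := isMeasurableFun.Build _ _ _ _ _ mXY.
pose XYm : {mfun Omega >-> (T1 * T2)%type} := HB.pack (fun o => (X o, Y o)) mXYmix.
by apply/esym; apply: (@product_measure_unique _ _ _ _ _ mu1 mu2 (distribution Pr XYm)).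
Qed.

Lemma law_complex_tuple n (Z : 'I_n -> Omega -> R[i]) :
  (forall i, measurable_fun [set: Omega] (Z i)) ->
  (forall i, is_CN01 Pr (Z i)) ->
  mutual_independence Pr (fun i => sigma_rv (Z i)) ->
  forall A, measurable A ->
    Pr ((fun o => [tuple Z i o | i < n]) @^-1` A) = complex_gauss n A.
Proof.
move=> mZ hZ indZ.
have mZt : measurable_fun [set: Omega] (fun o => [tuple Z i o | i < n]).
  exact: measurable_mktuple.
pose mZmix := isMeasurableFun.Build _ _ _ _ _ mZt.
pose Zm : {mfun Omega >-> n.-tuple R[i]} := HB.pack (fun o => [tuple Z i o | i < n]) mZmix.
apply: (complex_gauss_unique (m := distribution Pr Zm)) => A mA.
have := @mutual_independence_seq _ _ (enum 'I_n) (fun i => Z i @^-1` A i) indZ.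
rewrite enum_uniq => /(_ erefl) E.
transitivity (Pr (\bigcap_(i in [set` enum 'I_n]) (Z i @^-1` A i))).
  congr (Pr _); apply/seteqP; split => [w h i _ | w h i] /=.
    by have := h i; rewrite /= tnth_mktuple.
  by rewrite tnth_mktuple; apply: h; rewrite /= mem_enum.
rewrite E => [|i _]; last by exists (A i) => //; rewrite setTI.
by rewrite big_enum/=; apply: eq_bigr => i _; rewrite hZ// CN01E.
Qed.

Lemma law_fading_noise n (H : Omega -> R[i]) (Z : 'I_n -> Omega -> R[i]) :
  measurable_fun [set: Omega] H -> (forall i, measurable_fun [set: Omega] (Z i)) ->
  is_CN01 Pr H -> (forall i, is_CN01 Pr (Z i)) ->
  mutual_independence Pr
    (sum_family (fun _ : unit => sigma_rv H) (fun i => sigma_rv (Z i))) ->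
  forall A, measurable A ->
    Pr ((fun o => (H o, [tuple Z i o | i < n])) @^-1` A) =
    (complex_normal \x complex_gauss n)%E A.
Proof.
move=> mH mZ hH hZ ind A mA; apply: law_pair => //; first exact: measurable_mktuple.
move=> B C mB mC.
transitivity (Pr (H @^-1` B) * Pr ((fun o => [tuple Z i o | i < n]) @^-1` C))%E.
  2: rewrite hH// (law_complex_tuple mZ hZ _ mC)//.
  2: exact: (@mutual_independence_inj _ _ (@inr unit 'I_n) _ (fun i j => @inr_inj _ _ i j) ind).
apply: (@independent_blocks _ _ ind _ _ [set inl tt] (range inr)).
- by case=> [[]|i]; apply: sigma_rv_measurable.
- by case=> [[]|i]; exact: setI_closed_sigma_rv.
- by apply/seteqP; split => // -[i|i] [] //= _ [].
- apply: sub_sigma_algebra; exists (inl tt) => //.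
  by exists B => //; rewrite setTI.
- set G := \bigcup_(i in _) _.
  have : measurable_fun [set: g_sigma_algebraType G]
      (fun o : g_sigma_algebraType G => [tuple Z i o | i < n]).
    apply: measurable_mktuple => i; apply: measurable_sub_sigma => X ZX.
    by exists (inr i).
  by move=> /(_ measurableT _ mC); rewrite setTI.
Qed.

End independence_theory.

(** * The laws of L_n and S_n *)

Lemma xsection_preimage (T1 T2 : Type) (A : set (T1 * T2)) x :
  xsection A x = [set y | A (x, y)].
Proof. by apply/seteqP; split=> y; rewrite /xsection/= inE. Qed.

Section reference_sets.
Context {R : realType}.
Local Notation C := R[i].

Definition gain_corr n (P : R) (hz : C * n.-tuple C) : R :=
  correlation (const_input n (P * sqnorm hz.1)) hz.2.

(** [ref_L] and [ref_S] are [L_n] and [S_n] as functions of the fading and the noise vector, on a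
    space shared by the variables of the statement and those of the code. *)
Definition ref_L n (P : R) (hz : C * n.-tuple C) : R :=
  llr_L n (P * sqnorm hz.1) (energy hz.2) (gain_corr P hz).

Definition ref_S n (P : R) (hz : C * n.-tuple C) : R :=
  llr_S n (P * sqnorm hz.1) (energy hz.2) (gain_corr P hz).

Lemma correlation_const n g (z : n.-tuple C) :
  correlation (const_input n g) z = Num.sqrt g * \sum_(i < n) complex.Re (tnth z i).
Proof.
by rewrite mulr_sumr; apply: eq_bigr => i _ /=; rewrite mul0r addr0.
Qed.

Variables (n : nat) (P c : R).
Hypothesis P0 : 0 < P.
Local Notation T := (C * n.-tuple C)%type.
Local Notation joint := (complex_normal \x complex_gauss n)%E.

Let mgain : measurable_fun [set: T] (fun hz : T => P * sqnorm hz.1).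
Proof. by apply: measurable_funM => //; exact: measurable_sqnorm. Qed.

Let gain0 (hz : T) : 0 <= P * sqnorm hz.1.
Proof. by rewrite mulr_ge0 ?sqnorm_ge0// ltW. Qed.

Let menergy : measurable_fun [set: T] (fun hz : T => energy hz.2).
Proof. exact: (measurableT_comp (@measurable_energy _ n) measurable_snd). Qed.

Let mcorr : measurable_fun [set: T] (@gain_corr n P).
Proof.
rewrite /gain_corr; under eq_fun do rewrite correlation_const.
apply: measurable_funM.
  exact: (measurableT_comp (continuous_measurable_fun (@sqrt_continuous R)) mgain).
apply: measurable_sum => i.
apply: (measurableT_comp measurable_Re); apply: (measurableT_comp (@measurable_tnth _ _ n i)).
exact: measurable_snd.
Qed.

Lemma measurable_ref_L : measurable_fun [set: T] (@ref_L n P).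
Proof. exact: measurable_llr_L. Qed.

Lemma measurable_ref_S : measurable_fun [set: T] (@ref_S n P).
Proof. exact: measurable_llr_S. Qed.

Lemma measurable_ref_L_gt : measurable [set hz : T | c < ref_L P hz].
Proof.
rewrite (_ : mkset _ = @ref_L n P @^-1` `]c, +oo[%classic).
  by apply: measurable_preimageT => //; exact: measurable_ref_L.
by apply/seteqP; split=> hz; rewrite /= in_itv/= andbT.
Qed.

Lemma measurable_ref_S_gt : measurable [set hz : T | c < ref_S P hz].
Proof.
rewrite (_ : mkset _ = @ref_S n P @^-1` `]c, +oo[%classic).
  by apply: measurable_preimageT => //; exact: measurable_ref_S.
by apply/seteqP; split=> hz; rewrite /= in_itv/= andbT.
Qed.

Lemma measurable_ref_L_eq : measurable [set hz : T | ref_L P hz = c].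
Proof.
by apply: (measurable_preimageT measurable_ref_L (A := [set c])).
Qed.

(** A vanishing integral of nonnegative fibre probabilities makes almost every fibre null, and
    [llr_const_abs_cont] acts fibre by fibre. *)
Lemma joint_abs_cont :
  joint [set hz : T | c < ref_L P hz] = 0%E ->
  joint [set hz : T | c < ref_S P hz] = 0%E.
Proof.
rewrite /product_measure1 => L0.
have mx (A : set T) : measurable A ->
    measurable_fun [set: C] (fun h => complex_gauss n (xsection A h)).
  exact: measurable_fun_xsection.
have : ae_eq complex_normal setT
    (complex_gauss n \o xsection [set hz : T | c < ref_L P hz]) (cst 0%E).
  apply/(ae_eq_integral_abs complex_normal measurableT) => //.
    exact: (mx _ measurable_ref_L_gt).
  rewrite -[RHS]L0; apply: eq_integral => h _ /=.
  by rewrite gee0_abs.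
move=> L0ae.
rewrite -(integral0 complex_normal setT).
apply: ge0_ae_eq_integral => //.
  exact: (mx _ measurable_ref_S_gt).
apply: filterS L0ae => h L0h _.
have g0 : 0 <= P * sqnorm h by rewrite mulr_ge0 ?sqnorm_ge0// ltW.
have Lh : complex_gauss n [set z | c < ref_L P (h, z)] = 0%E.
  have := L0h I; rewrite [in X in X -> _]/comp xsection_preimage; exact.
rewrite /comp xsection_preimage; exact: (llr_const_abs_cont g0 Lh).
Qed.

End reference_sets.

Lemma complex_normal_sqnorm0 (R : realType) :
  complex_normal [set h : R[i] | sqnorm h = 0] = 0%E.
Proof.
pose A : set (measurableTypeR R) := [set 0].
have nuA : half_normal A = 0%E.
  have -> : A = [set x | 1 * x ^+ 2 + 0 * x + 0 = 0].
    apply/seteqP; split=> x /=; first by move=> ->; ring.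
    by rewrite mul1r mul0r !addr0 => /eqP; rewrite sqrf_eq0 => /eqP.
  by apply: half_normal_quadratic; rewrite oner_eq0.
have mA : measurable A by exact: measurable_set1.
have mN : measurable [set h : R[i] | sqnorm h = 0].
  apply: (measurable_preimageT (f := @sqnorm R) (A := [set 0])) => //.
  exact: measurable_sqnorm.
apply/eqP; rewrite eq_le measure_ge0 andbT.
rewrite -[leLHS]/((half_normal \x half_normal)%E (@complex_of_pair R @^-1` [set h | sqnorm h = 0])).
have <- : (half_normal \x half_normal)%E (A `*` setT) = 0%E.
  apply: etrans (product_measure1E _ _ mA measurableT) _.
  by rewrite [X in (X * _)%E]nuA mul0e.
apply: le_measure; rewrite ?inE.
- by apply: measurable_preimageT mN; exact: measurable_complex_of_pair.
- exact: measurableX.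
move=> -[x y] /= /eqP; rewrite /sqnorm/= paddr_eq0 ?sqr_ge0// => /andP[]; rewrite sqrf_eq0 => /eqP.
by split.
Qed.

(** The value [h = 0] must be set aside: there the log-likelihood ratio is identically 0, a genuine
    atom, but [h = 0] has probability zero. *)
Lemma joint_L_atomless (R : realType) m (P c : R) : 0 < P ->
  (complex_normal \x complex_gauss m.+1)%E
    [set hz : R[i] * m.+1.-tuple R[i] | ref_L P hz = c] = 0%E.
Proof.
move=> P0; have mE := @measurable_ref_L_eq R m.+1 P c.
have key h : sqnorm h <> 0 -> complex_gauss m.+1
    (xsection [set hz : R[i] * m.+1.-tuple R[i] | ref_L P hz = c] h) = 0%E.
  move=> h0; have g0 : 0 < P * sqnorm h.
    by rewrite mulr_gt0// lt_neqAle sqnorm_ge0 andbT eq_sym; apply/eqP.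
  rewrite xsection_preimage; exact: (@llr_L_atomless R m _ c g0).
rewrite /product_measure1 -(integral0 complex_normal setT).
apply: ge0_ae_eq_integral => //.
  exact: measurable_fun_xsection.
exists [set h : R[i] | sqnorm h = 0]; split.
- apply: (measurable_preimageT (f := @sqnorm R) (A := [set 0])) => //.
  exact: measurable_sqnorm.
- exact: complex_normal_sqnorm0.
by move=> h /not_implyP[_ nk]; apply: contrapT => h0; exact: (nk (key h h0)).
Qed.

Lemma sum_affine (R : realType) n (u v : 'I_n -> R) (a b k : R) :
  \sum_(i < n) (a * u i + b * v i + k) =
  a * (\sum_(i < n) u i) + b * (\sum_(i < n) v i) + n%:R * k.
Proof. by rewrite !big_split/= -!mulr_sumr sumr_const card_ord mulr_natl. Qed.

Section reference_laws.
Context d (Omega : measurableType d) (R : realType) (Pr : probability Omega R).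
Variables (P : R) (n : nat) (H : {RV Pr >-> R[i]}) (Z : nat -> {RV Pr >-> R[i]}).
Hypothesis P0 : 0 < P.

Let Zt o := [tuple Z i o | i < n].

Lemma info_LE o : info_L P H Z n o = ref_L P (H o, Zt o).
Proof.
rewrite /info_L /ref_L /llr_L /gain_corr /fading_gain normc_sqr /=.
have g0 : 0 <= P * sqnorm (H o) by rewrite mulr_ge0 ?sqnorm_ge0// ltW.
congr (_ + _); rewrite correlation_const.
set g := P * _ in g0 *.
(* Each expanded summand is affine in [|Z_i|^2] and [Re Z_i]; summing gives the energy and the
   correlation with the constant input. *)
transitivity (\sum_(i < n) (- g * sqnorm (Z i o) +
    Num.sqrt (1 + g) * Num.sqrt g *+ 2 * complex.Re (Z i o) + - g)).
  apply: eq_bigr => i _; rewrite normc_sqr; case: (Z i o) => x y.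
  have sg : Num.sqrt g ^+ 2 = g by rewrite sqr_sqrtr.
  have sg1 : Num.sqrt (1 + g) ^+ 2 = 1 + g by rewrite sqr_sqrtr// addr_ge0.
  move: (Num.sqrt g) (Num.sqrt (1 + g)) sg sg1 => s t sg sg1.
  rewrite /sqnorm/=.
  transitivity (1 - (s ^+ 2 * (x ^+ 2 + y ^+ 2) - t * (s * x) *+ 2 + t ^+ 2)).
    by ring.
  by rewrite sg1 sg; ring.
rewrite sum_affine.
have -> : energy (Zt o) = \sum_(i < n) sqnorm (Z i o).
  by apply: eq_bigr => i _; rewrite tnth_mktuple.
have -> : \sum_(i < n) complex.Re (tnth (Zt o) i) = \sum_(i < n) complex.Re (Z i o).
  by apply: eq_bigr => i _; rewrite tnth_mktuple.
by ring.
Qed.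

Lemma info_SE o : info_S P H Z n o = ref_S P (H o, Zt o).
Proof.
rewrite /info_S /ref_S /llr_S /gain_corr /fading_gain normc_sqr /=.
have g0 : 0 <= P * sqnorm (H o) by rewrite mulr_ge0 ?sqnorm_ge0// ltW.
congr (_ + _); rewrite correlation_const.
set g := P * _ in g0 *.
have g1 : 1 + g != 0 by rewrite gt_eqF// ltr_wpDr.
transitivity (\sum_(i < n) (((1 + g)^-1 - 1) * sqnorm (Z i o) +
    Num.sqrt g / (1 + g) *+ 2 * complex.Re (Z i o) + g / (1 + g))).
  apply: eq_bigr => i _; rewrite normc_sqr; case: (Z i o) => x y.
  have sg : Num.sqrt g ^+ 2 = g by rewrite sqr_sqrtr.
  move: (Num.sqrt g) sg => s sg.
  rewrite /sqnorm/=.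
  transitivity (1 - (s ^+ 2 * (x ^+ 2 + y ^+ 2) - (s * x) *+ 2 + 1) / (1 + g)).
    by congr (1 - _ / _); ring.
  by rewrite sg; field.
rewrite sum_affine.
have -> : energy (Zt o) = \sum_(i < n) sqnorm (Z i o).
  by apply: eq_bigr => i _; rewrite tnth_mktuple.
have -> : \sum_(i < n) complex.Re (tnth (Zt o) i) = \sum_(i < n) complex.Re (Z i o).
  by apply: eq_bigr => i _; rewrite tnth_mktuple.
by field.
Qed.

Hypotheses (hH : is_CN01 Pr H) (hZ : forall i, is_CN01 Pr (Z i)).
Hypothesis hHZ : mutual_independence Pr
  (sum_family (fun _ : unit => sigma_rv H) (fun i : nat => sigma_rv (Z i))).

Lemma law_reference A : measurable A ->
  Pr [set o | A (H o, Zt o)] = (complex_normal \x complex_gauss n)%E A.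
Proof.
apply: (@law_fading_noise _ _ _ Pr n H (fun i => Z i)) => //.
pose f (k : unit + 'I_n) : unit + nat :=
  match k with inl u => inl u | inr i => inr (nat_of_ord i) end.
have injf : injective f.
  by move=> [[]|i] [[]|j] //= [] /val_inj ->.
have := mutual_independence_inj injf hHZ.
by congr mutual_independence; apply/funext => -[].
Qed.

End reference_laws.

(** * The converse for a single user *)

(** Serves to integrate the Neyman-Pearson inequality over the fading and then over the environment.
    The additive form with nonnegative terms keeps linearity available in the extended reals. *)
Lemma le_integral_affine d (T : measurableType d) (R : realType)
    (mu : probability T R) (f1 f2 f3 f4 : T -> \bar R) (k : R) : 0 <= k ->
  measurable_fun [set: T] f1 -> measurable_fun [set: T] f2 ->
  measurable_fun [set: T] f3 -> measurable_fun [set: T] f4 ->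
  (forall x, 0 <= f1 x)%E -> (forall x, 0 <= f2 x)%E ->
  (forall x, 0 <= f3 x)%E -> (forall x, 0 <= f4 x)%E ->
  {ae mu, forall x, (f1 x + k%:E * f2 x <= f3 x + k%:E * f4 x)%E} ->
  (\int[mu]_x f1 x + k%:E * \int[mu]_x f2 x <=
   \int[mu]_x f3 x + k%:E * \int[mu]_x f4 x)%E.
Proof.
move=> k0 m1 m2 m3 m4 p1 p2 p3 p4 le.
have mk f : measurable_fun [set: T] f ->
    measurable_fun [set: T] (fun x => k%:E * f x)%E.
  by move=> mf; exact: emeasurable_funM.
have pk (f : T -> \bar R) : (forall x, 0 <= f x)%E -> forall x, (0 <= k%:E * f x)%E.
  by move=> f0 x; rewrite mule_ge0.
have E (f g : T -> \bar R) : measurable_fun [set: T] f -> measurable_fun [set: T] g ->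
    (forall x, 0 <= f x)%E -> (forall x, 0 <= g x)%E ->
    (\int[mu]_x f x + k%:E * \int[mu]_x g x =
     \int[mu]_x (f x + k%:E * g x))%E.
  move=> mf mg f0 g0.
  rewrite -(ge0_integralZl mu measurableT mg (fun x _ => g0 x)) ?lee_fin//.
  rewrite -(ge0_integralD mu measurableT (fun x _ => f0 x) mf
    (fun x _ => pk _ g0 x) (mk _ mg)).
  reflexivity.
rewrite !E//; apply: ae_ge0_le_integral => //.
- by move=> x _; rewrite adde_ge0// pk.
- by apply: emeasurable_funD => //; exact: mk.
- by move=> x _; rewrite adde_ge0// pk.
- by apply: emeasurable_funD => //; exact: mk.
- by apply: filterS le => x h _.
Qed.

Lemma measurable_fun_fin_index d d' (T : measurableType d)
    (T' : measurableType d') (I : finType) (W : T -> I) (f : I -> T -> T') :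
  (forall w, measurable (W @^-1` [set w])) ->
  (forall w, measurable_fun [set: T] (f w)) ->
  measurable_fun [set: T] (fun t => f (W t) t).
Proof.
move=> mW mf _ B mB; rewrite setTI.
have -> : (fun t => f (W t) t) @^-1` B =
    \bigcup_(w in [set: I]) (W @^-1` [set w] `&` f w @^-1` B).
  by apply/seteqP; split=> [t Bt|t [w _ [/= <-]]//]; exists (W t).
apply: fin_bigcup_measurable => [|w _]; first exact: finite_finset.
by apply: measurableI => //; exact: measurable_preimageT.
Qed.

Lemma measure_bigcup_seq_le d (T : measurableType d) (R : realType)
    (mu : {measure set T -> \bar R}) (I : choiceType) (s : seq I)
    (A : I -> set T) : (forall i, measurable (A i)) ->
  (mu (\bigcup_(i in [set` s]) A i) <= \sum_(i <- s) mu (A i))%E.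
Proof.
move=> mA; rewrite bigcup_seq; elim: s => [|i s ih]; first by rewrite !big_nil measure0.
rewrite !big_cons; apply: le_trans (leeD2l _ ih).
by apply: measureU2 => //; exact: bigsetU_measurable.
Qed.

Lemma sum_tradeoff (R : realFieldType) n (u v : 'I_n -> R) (s p e k : R) :
  (forall i, u i + e * p <= s + e * v i) -> \sum_(i < n) v i = k ->
  \sum_(i < n) u i + n%:R * (e * p) <= n%:R * s + e * k.
Proof.
move=> uv vk; have : \sum_(i < n) (u i + e * p) <= \sum_(i < n) (s + e * v i).
  by apply: ler_sum => i _; exact: uv.
by rewrite big_split [leRHS]big_split/= !sumr_const card_ord -mulr_sumr vk !mulr_natl.
Qed.

Section single_user.
Context (R : realType) (Ka M m : nat) dU (U : measurableType dU)
  dV (V : measurableType dV) (c : randomized_code R Ka M m U V)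
  d (Omega : measurableType d) (Pr : probability Omega R) (a : mac_use c Pr)
  (j : 'I_Ka).
Local Notation C := R[i].
Local Notation CT := (C * m.-tuple C)%type.
Local Notation index := ('I_Ka + ('I_Ka + ('I_Ka + ('I_m + unit))))%type.

Definition mac_family : index -> set (set Omega) :=
  sum_family (fun i => sigma_fin (message a i))
  (sum_family (fun i => sigma_rv (encoder_seed a i))
  (sum_family (fun i => sigma_rv (fading a i))
  (sum_family (fun k => sigma_rv (noise a k))
              (fun _ : unit => sigma_rv (decoder_seed a))))).

Let F_independent : mutual_independence Pr mac_family.
Proof. exact: mac_independence. Qed.

Let F_measurable i : mac_family i `<=` measurable.
Proof.
case: i => [i|[i|[i|[i|i]]]]; [|exact: sigma_rv_measurable..].
by apply: sigma_fin_measurable => w; exact: message_measurable.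
Qed.

Let F_setI i : setI_closed (mac_family i).
Proof.
by case: i => [i|[i|[i|[i|i]]]]; [exact: setI_closed_sigma_fin|exact: setI_closed_sigma_rv..].
Qed.

Let ix_message i : index := inl i.
Let ix_seed i : index := inr (inl i).
Let ix_fading i : index := inr (inr (inl i)).
Let ix_noise k : index := inr (inr (inr (inl k))).
Let ix_decoder : index := inr (inr (inr (inr tt))).

Let channel_ix : set index := [set ix_fading j] `|` range ix_noise.
(** The encoder seed of [j] stays in the environment: once this is fixed, every possible codeword of
    [j] is deterministic, while the message actually sent remains unknown. *)
Let other_ix : set index := ~` [set ix_message j] `&` ~` channel_ix.

Local Notation gen D := (\bigcup_(i in D) mac_family i).
Local Notation sub D := (g_sigma_algebraType (gen D)).

(* The sample space with the information on everything but the message, the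
   fading of user j and the noise. *)
Definition environment := sub other_ix.

Let measurable_seed D i : D (ix_seed i) ->
  measurable_fun [set: sub D] (encoder_seed a i : sub D -> U).
Proof. by move=> Di; apply: measurable_sub_sigma => X; exists (ix_seed i). Qed.

Let measurable_fading D i : D (ix_fading i) ->
  measurable_fun [set: sub D] (fading a i : sub D -> C).
Proof. by move=> Di; apply: measurable_sub_sigma => X; exists (ix_fading i). Qed.

Let measurable_noise D k : D (ix_noise k) ->
  measurable_fun [set: sub D] (noise a k : sub D -> C).
Proof. by move=> Di; apply: measurable_sub_sigma => X; exists (ix_noise k). Qed.

Let measurable_decoder_seed D : D ix_decoder ->
  measurable_fun [set: sub D] (decoder_seed a : sub D -> V).
Proof. by move=> Di; apply: measurable_sub_sigma => X; exists ix_decoder. Qed.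

Let measurable_message D i w : D (ix_message i) ->
  measurable ((message a i : sub D -> 'I_M) @^-1` [set w]).
Proof.
move=> Di; apply: sub_sigma_algebra; exists (ix_message i) => //.
by exists [set w] => //; rewrite setTI.
Qed.

Let other_seed i : other_ix (ix_seed i).
Proof. by split => //; case=> // -[]. Qed.

Let other_decoder : other_ix ix_decoder.
Proof. by split => //; case=> // -[]. Qed.

Let other_fading i : i != j -> other_ix (ix_fading i).
Proof.
by move=> /eqP ij; split => //; case=> [[]|[]] //.
Qed.

Let other_message i : i != j -> other_ix (ix_message i).
Proof. by move=> /eqP ij; split=> [[]|[|[]]] //. Qed.

(** The identity, changing only the sigma-algebra; [env_law] is thus [Pr] restricted to the
    environment. *)
Definition env_map : Omega -> environment := id.

Let env_map_measurable : measurable_fun [set: Omega] env_map.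
Proof.
move=> _ B mB; rewrite setTI.
apply: (smallest_sub _ _ mB); first exact: sigma_algebra_measurable.
by move=> X [i _ FX]; exact: F_measurable FX.
Qed.

HB.instance Definition _ :=
  isMeasurableFun.Build _ _ _ _ env_map env_map_measurable.

Definition env_law : probability environment R := distribution Pr env_map.

Let noise_vec (o : Omega) : m.-tuple C := [tuple noise a k o | k < m].

Let chan (o : Omega) : CT := (fading a j o, noise_vec o).

Let joint : probability CT R := (complex_normal \x complex_gauss m)%E.

Let chan_sub D : channel_ix `<=` D ->
  measurable_fun [set: sub D] (chan : sub D -> CT).
Proof.
move=> cD; apply/measurable_fun_pair => /=.
  by apply: measurable_fading; apply: cD; left.
by apply: measurable_mktuple => k; apply: measurable_noise; apply: cD; right; exists k.
Qed.

Let law_chan A : measurable A -> Pr (chan @^-1` A) = joint A.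
Proof.
apply: law_fading_noise => //.
- exact: fading_law.
- exact: noise_law.
pose f (k : unit + 'I_m) : index :=
  match k with inl _ => ix_fading j | inr k => ix_noise k end.
have injf : injective f by move=> [[]|k] [[]|l] //= [] ->.
have := mutual_independence_inj injf F_independent.
by congr mutual_independence; apply/funext => -[].
Qed.

Let law_env_chan (A : set (environment * CT)) : measurable A ->
  Pr ((fun o => (env_map o, chan o)) @^-1` A) = (env_law \x joint)%E A.
Proof.
move=> mA; apply: (@law_pair _ _ _ Pr _ _ environment CT env_law joint env_map chan _ _ _ A mA).
- exact: env_map_measurable.
- by apply/measurable_fun_pair => /=; [|exact: measurable_mktuple].
move=> B D mB mD.
transitivity (Pr (env_map @^-1` B) * Pr (chan @^-1` D))%E; last by rewrite law_chan.
apply: (@independent_blocks _ _ _ _ _ _ F_independent F_measurable F_setI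
  other_ix channel_ix).
- by apply/seteqP; split => // i [[_ ni] ci]; exact: ni ci.
- exact: mB.
- by have := @chan_sub channel_ix (fun _ => id) measurableT D mD; rewrite setTI.
Qed.

Let interference (o : environment) (k : 'I_m) : C :=
  \sum_(i < Ka | i != j) fading a i o * tnth (channel_input a i o) k.

Let measurable_interference k :
  measurable_fun [set: environment] (fun o => interference o k).
Proof.
rewrite /interference (_ : (fun o => _) = (fun o : environment =>
    \sum_(i < Ka) (if i != j then fading a i o * tnth (channel_input a i o) k else 0))).
  apply: measurable_complex_sum => i; have [->|ij] := eqVneq i j.
    exact: measurable_cst.
  apply: measurable_complexM.
    by apply: measurable_fading; exact: other_fading.
  apply: (measurableT_comp (@measurable_tnth _ _ _ k)).
  apply: (@measurable_fun_fin_index _ _ environment _ _ (message a i)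
    (fun w o => encoder c w (encoder_seed a i o))).
    by move=> w; apply: measurable_message; exact: other_message.
  move=> w; apply: (measurableT_comp (measurable_funPT (encoder c w))).
  by apply: measurable_seed.
by apply/funext => o; rewrite big_mkcond.
Qed.

Let accept w : set (m.-tuple C * V) := [set yv | w \in decoder c yv].

Let measurable_accept w : measurable (accept w).
Proof.
have -> : accept w = \bigcup_(s in [set s : {set 'I_M} | w \in s]) decoder c @^-1` [set s].
  apply/seteqP; split=> [yv h|yv [s /= ws ys]]; first by exists (decoder c yv).
  by rewrite /accept/= ys.
apply: fin_bigcup_measurable => [|s _]; first exact: finite_finset.
exact: decoder_measurable.
Qed.

(** With interference and decoder seed frozen, the decoder becomes a deterministic test on [y], the
    signal of [j] plus noise; the interference is added back before decoding. *)
Let region w (e : environment) : set (m.-tuple C) :=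
  [set y | accept w ([tuple tnth y k + interference e k | k < m], decoder_seed a e)].

Let measurable_region_fun w d' (T : measurableType d') (e : T -> environment)
    (y : T -> m.-tuple C) :
  measurable_fun [set: T] e -> measurable_fun [set: T] y ->
  measurable [set t | region w (e t) (y t)].
Proof.
move=> me my; apply: (measurable_preimageT (f := fun t =>
  ([tuple tnth (y t) k + interference (e t) k | k < m], decoder_seed a (e t))))
  (measurable_accept w).
apply/measurable_fun_pair => /=.
  apply: measurable_mktuple => k; apply: measurable_complexD.
    exact: (measurableT_comp (@measurable_tnth _ _ _ k)).
  exact: (measurableT_comp (measurable_interference k)).
exact: (measurableT_comp (measurable_decoder_seed other_decoder) me).
Qed.

Let measurable_region w e : measurable (region w e).
Proof.
apply: (@measurable_region_fun w _ _ (fun=> e) id); first exact: measurable_cst.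
exact: measurable_id.
Qed.

Let codeword w (e : environment) (k : 'I_m) : C :=
  tnth (encoder c w (encoder_seed a j e)) k.

(* [hit w]: the message [w], once sent, is decoded over the true channel;
   [blind w]: it is decoded over the reference channel, which ignores it. *)
Let hit w : set (environment * CT) :=
  [set q | region w q.1 (translate (fun k => q.2.1 * codeword w q.1 k) q.2.2)].

Variable P : R.
Hypothesis P0 : 0 < P.

Let blind w : set (environment * CT) :=
  [set q | region w q.1 (dilate (Num.sqrt (1 + P * sqnorm q.2.1)) q.2.2)].

Let measurable_hit w : measurable (hit w).
Proof.
apply: (@measurable_region_fun w _ _ fst
  (fun q : environment * CT => translate (fun k => q.2.1 * codeword w q.1 k) q.2.2)) => //.
apply: measurable_mktuple => k; apply: measurable_complexD; last first.
  apply: (measurableT_comp (@measurable_tnth _ _ _ k)).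
  exact: (measurableT_comp measurable_snd measurable_snd).
apply: measurable_complexM; first exact: (measurableT_comp measurable_fst measurable_snd).
apply: (measurableT_comp (@measurable_tnth _ _ _ k)).
apply: (measurableT_comp (measurable_funPT (encoder c w))).
exact: (measurableT_comp (measurable_seed (other_seed j)) measurable_fst).
Qed.

Let measurable_blind w : measurable (blind w).
Proof.
apply: (@measurable_region_fun w _ _ fst
  (fun q : environment * CT => dilate (Num.sqrt (1 + P * sqnorm q.2.1)) q.2.2)) => //.
apply: measurable_mktuple => k; apply: measurable_complexM; last first.
  apply: (measurableT_comp (@measurable_tnth _ _ _ k)).
  exact: (measurableT_comp measurable_snd measurable_snd).
apply: measurable_real_complex.
apply: (measurableT_comp (continuous_measurable_fun (@sqrt_continuous R))).
apply: measurable_funD => //; apply: measurable_funM => //; apply: measurable_sqnorm.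
exact: (measurableT_comp measurable_fst measurable_snd).
Qed.

Let jointS : probability (C * m.+1.-tuple C)%type R :=
  (complex_normal \x complex_gauss m.+1)%E.

(** For a frozen environment, [converse_fixed_fading] holds for each fading [h] with the same
    threshold [t], and is integrated over [h]. *)
Let hit_vs_blind_env w e (t : R) :
  \sum_(k < m) sqnorm (codeword w e k) <= m%:R * P ->
  (joint (xsection (hit w) e) +
     (expR t)%:E * jointS [set hz : C * m.+1.-tuple C | (t < ref_L P hz)%R] <=
   jointS [set hz : C * m.+1.-tuple C | (t < ref_S P hz)%R] +
     (expR t)%:E * joint (xsection (blind w) e))%E.
Proof.
move=> pw; apply: le_integral_affine; first exact: expR_ge0.
- by apply: measurable_fun_xsection; exact: measurable_xsection.
- by apply: measurable_fun_xsection; exact: measurable_ref_L_gt.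
- by apply: measurable_fun_xsection; exact: measurable_ref_S_gt.
- by apply: measurable_fun_xsection; exact: measurable_xsection.
- by move=> h; exact: measure_ge0.
- by move=> h; exact: measure_ge0.
- by move=> h; exact: measure_ge0.
- by move=> h; exact: measure_ge0.
apply: aeW => h; rewrite /comp !xsection_preimage.
exact: (@converse_fixed_fading R m P t h (codeword w e) (region w e)
  (ltW P0) pw (measurable_region w e)).
Qed.

Hypothesis hpower : max_power_constraint c P.

(** The power constraint holds almost everywhere for the law of the seed; the exceptional set is
    pulled back through the seed of [j]. *)
Let power_env w :
  {ae env_law, forall e, \sum_(k < m) sqnorm (codeword w e k) <= m%:R * P}.
Proof.
have [N [mN N0 sN]] := hpower w.
exists (encoder_seed a j @^-1` N); split.
- by apply: measurable_preimageT mN; exact: measurable_seed.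
- by rewrite -[LHS]/(Pr (encoder_seed a j @^-1` N)) encoder_seed_law.
move=> e ne; apply: sN => /= pw; apply: ne; move: pw.
by congr (_ <= _); apply: eq_bigr => k _; rewrite normc_sqr.
Qed.

Lemma hit_vs_blind w (t : R) :
  ((env_law \x joint) (hit w) +
     (expR t)%:E * jointS [set hz : C * m.+1.-tuple C | (t < ref_L P hz)%R] <=
   jointS [set hz : C * m.+1.-tuple C | (t < ref_S P hz)%R] +
     (expR t)%:E * (env_law \x joint) (blind w))%E.
Proof.
have cstE (x : \bar R) : (\int[env_law]_e x = x)%E.
  rewrite integral_cst// -[RHS]mule1.
  by congr (_ * _)%E; exact: (probability_setT env_law).
have gen (x y : \bar R) : (0 <= x)%E -> (0 <= y)%E ->
    {ae env_law, forall e, (joint (xsection (hit w) e) + (expR t)%:E * x <=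
       y + (expR t)%:E * joint (xsection (blind w) e))%E} ->
    ((env_law \x joint) (hit w) + (expR t)%:E * x <=
       y + (expR t)%:E * (env_law \x joint) (blind w))%E.
  move=> x0 y0 le; rewrite -(cstE x) -(cstE y).
  apply: le_integral_affine le; first exact: expR_ge0.
  - exact: measurable_fun_xsection.
  - exact: measurable_cst.
  - exact: measurable_cst.
  - exact: measurable_fun_xsection.
  - by move=> e; exact: measure_ge0.
  - by move=> e.
  - by move=> e.
  - by move=> e; exact: measure_ge0.
apply: gen; [exact: measure_ge0|exact: measure_ge0|].
by apply: filterS (power_env w) => e; exact: hit_vs_blind_env.
Qed.

Let correct : set Omega :=
  [set o | message a j o \in decoder c (channel_output a o, decoder_seed a o)].

Let correctE : correct = \bigcup_(w in [set: 'I_M])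
  (message a j @^-1` [set w] `&` (fun o => (env_map o, chan o)) @^-1` hit w).
Proof.
have outE o : [tuple tnth (translate (fun k => fading a j o * codeword (message a j o) o k)
      (noise_vec o)) k + interference o k | k < m] = channel_output a o.
  apply: eq_from_tnth => k; rewrite !tnth_mktuple [in RHS](bigD1 j)//=.
  by rewrite addrAC.
apply/seteqP; split=> [w h|w [v _ [/= <-]]].
  exists (message a j w) => //; split => //.
  by rewrite /hit /region /accept /= outE.
by rewrite /hit /region /accept /= outE.
Qed.

Let measurable_env_chan : measurable_fun [set: Omega] (fun o => (env_map o, chan o)).
Proof.
apply/measurable_fun_pair; first exact: env_map_measurable.
by apply/measurable_fun_pair => /=; [|exact: measurable_mktuple].
Qed.

Let measurable_correct_at w :
  measurable (message a j @^-1` [set w] `&` (fun o => (env_map o, chan o)) @^-1` hit w).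
Proof.
apply: measurableI; first exact: message_measurable.
exact: (measurable_preimageT measurable_env_chan (measurable_hit w)).
Qed.

Let measurable_correct : measurable correct.
Proof.
by rewrite correctE; apply: fin_bigcup_measurable => //; exact: finite_finset.
Qed.

(** [hit w] uses the fixed codeword of [w] and not the message sent, so it is determined by all the
    variables other than that message, hence is independent of it. *)
Let correct_at w :
  (Pr (message a j @^-1` [set w] `&` (fun o => (env_map o, chan o)) @^-1` hit w) =
   (M%:R^-1)%:E * (env_law \x joint) (hit w))%E.
Proof.
rewrite -law_env_chan; last exact: measurable_hit.
rewrite -(message_uniform a j w).
pose D := ~` [set ix_message j].
apply: (@independent_blocks _ _ _ _ _ _ F_independent F_measurable F_setI
  [set ix_message j] D).
- by rewrite setICr.
- apply: sub_sigma_algebra; exists (ix_message j) => //.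
  by exists [set w] => //; rewrite setTI.
have : measurable_fun [set: sub D]
    (fun o : sub D => ((o : environment), chan o)).
  apply/measurable_fun_pair.
    move=> _ B mB; rewrite setTI; apply: (smallest_sub _ _ mB).
      exact: smallest_sigma_algebra.
    by move=> X [i [ij _] FX]; apply: sub_sigma_algebra; exists i.
  by apply: chan_sub => i [->|[k _ <-]].
by move=> /(_ measurableT _ (measurable_hit w)); rewrite setTI.
Qed.

Let correct_le :
  (Pr correct <= \sum_(w < M) (M%:R^-1)%:E * (env_law \x joint) (hit w))%E.
Proof.
have -> : correct = \bigcup_(w in [set` index_enum 'I_M])
    (message a j @^-1` [set w] `&` (fun o => (env_map o, chan o)) @^-1` hit w).
  rewrite correctE; congr (bigcup _ _).
  by apply/seteqP; split=> w //= _; exact: mem_index_enum.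
apply: le_trans (measure_bigcup_seq_le Pr _ measurable_correct_at) _.
apply: lee_sum => w _; rewrite le_eqVlt; apply/orP; left; apply/eqP.
exact: correct_at.
Qed.

(** The reference output is the same for all [w], so at each sample point the number of [w] with
    [blind w] is the size [Ka] of one decoded list. *)
Let sum_blind : (\sum_(w < M) (env_law \x joint) (blind w) = Ka%:R%:E)%E.
Proof.
have mb w : measurable_fun [set: environment * CT] (fun q => (\1_(blind w) q)%:E : \bar R).
  by apply/measurable_EFinP.
transitivity (\sum_(w < M) \int[(env_law \x joint)%E]_q (\1_(blind w) q)%:E)%E.
  apply: eq_bigr => w _.
  by rewrite (integral_indic (env_law \x joint)%E measurableT (measurable_blind w)) setIT.
rewrite -(ge0_integral_sum (env_law \x joint)%E measurableT)//.
transitivity (\int[(env_law \x joint)%E]_q (Ka%:R%:E : \bar R))%E.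
  apply: eq_integral => q _; rewrite sumEFin; congr EFin.
  rewrite -(decoder_card c ([tuple tnth (dilate (Num.sqrt (1 + P * sqnorm q.2.1)) q.2.2) k
      + interference q.1 k | k < m], decoder_seed a q.1)).
  rewrite -sum1_card natr_sum [RHS]big_mkcond/=; apply: eq_bigr => w _.
  rewrite indicE; case: ifPn => wd.
    by rewrite mem_set.
  by rewrite memNset//; exact/negP.
rewrite integral_cst// -[RHS]mule1.
by congr (_ * _)%E; exact: (probability_setT (env_law \x joint)%E).
Qed.

Lemma measurable_error_event : measurable (error_event a j).
Proof.
apply: measurableU.
  rewrite (_ : [set o | _] = ~` correct); first exact: measurableC.
  by apply/seteqP; split=> o /= /negP.
rewrite (_ : [set o | _] = \bigcup_(p in [set p : 'I_Ka * 'I_M | p.1 != j])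
    (message a j @^-1` [set p.2] `&` message a p.1 @^-1` [set p.2])).
  apply: fin_bigcup_measurable => [|p _]; first exact: finite_finset.
  by apply: measurableI; exact: message_measurable.
apply/seteqP; split=> [w [i ij e]|w [[i v] /= ij [e1 e2]]].
  by exists (i, message a j w).
by exists i => //; rewrite e1 e2.
Qed.

(** Summing [hit_vs_blind] over the messages gives [(1 - eps) M + e^t M p_L <= M (1 - eps) + e^t
    Ka]; the terms in [1 - eps] cancel and [e^t] is divided out. *)
Lemma single_user_converse (eps t : R) :
  (Pr (error_event a j) <= eps%:E)%E ->
  (jointS [set hz : C * m.+1.-tuple C | (t < ref_S P hz)%R] <= (1 - eps)%:E)%E ->
  (M%:R%:E * jointS [set hz : C * m.+1.-tuple C | (t < ref_L P hz)%R] <= Ka%:R%:E)%E.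
Proof.
move=> err_le S_le.
have M0 : (0 < M%:R :> R).
  rewrite ltr0n; apply: leq_ltn_trans (ltn_ord (message a j point)).
  exact: leq0n.
have correct_ge : ((1 - eps)%:E <= Pr correct)%E.
  have le1 : (Pr (~` correct) <= eps%:E)%E.
    apply: le_trans err_le; apply: le_measure.
    - by rewrite inE; exact: measurableC.
    - by rewrite inE; exact: measurable_error_event.
    - by move=> o no; left; apply/negP; exact: no.
  rewrite EFinB leeBlDr//; apply: le_trans (leeD2l _ le1).
  apply: le_trans (measureU2 Pr measurable_correct (measurableC measurable_correct)).
  rewrite setUv le_eqVlt; apply/orP; left; apply/eqP/esym.
  exact: (probability_setT Pr).
have [pL pLE] : exists p, jointS [set hz : C * m.+1.-tuple C | (t < ref_L P hz)%R] = p%:E.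
  exists (fine (jointS [set hz : C * m.+1.-tuple C | (t < ref_L P hz)%R])).
  by rewrite fineK// fin_num_measure//; exact: measurable_ref_L_gt.
have [pS pSE] : exists p, jointS [set hz : C * m.+1.-tuple C | (t < ref_S P hz)%R] = p%:E.
  exists (fine (jointS [set hz : C * m.+1.-tuple C | (t < ref_S P hz)%R])).
  by rewrite fineK// fin_num_measure//; exact: measurable_ref_S_gt.
pose Q : probability (environment * CT)%type R := (env_law \x joint)%E.
have [al alE] : exists al, forall w, (env_law \x joint)%E (hit w) = (al w)%:E.
  exists (fun w => fine ((env_law \x joint)%E (hit w))) => w.
  by rewrite fineK//; exact: (fin_num_measure Q _ (measurable_hit w)).
have [be beE] : exists be, forall w, (env_law \x joint)%E (blind w) = (be w)%:E.
  exists (fun w => fine ((env_law \x joint)%E (blind w))) => w.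
  by rewrite fineK//; exact: (fin_num_measure Q _ (measurable_blind w)).
have {}S_le : pS <= 1 - eps by rewrite -lee_fin -pSE.
have ineq w : al w + expR t * pL <= (1 - eps) + expR t * be w.
  apply: (@le_trans _ _ (pS + expR t * be w)); last by rewrite lerD2r.
  have := hit_vs_blind w t; rewrite alE beE pLE pSE -!EFinM -!EFinD lee_fin.
  by [].
have sum_be : \sum_(w < M) be w = Ka%:R.
  apply: EFin_inj; rewrite -sum_blind -sumEFin; apply: eq_bigr => w _.
  by rewrite beE.
have sum_al : (1 - eps) * M%:R <= \sum_(w < M) al w.
  have : (1 - eps <= M%:R^-1 * \sum_(w < M) al w)%R.
    rewrite -lee_fin; apply: le_trans correct_ge _.
    apply: le_trans correct_le _; rewrite mulr_sumr -sumEFin.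
    by apply: lee_sum => w _; rewrite alE EFinM.
  by rewrite mulrC ler_pdivlMr.
have total := sum_tradeoff ineq sum_be.
rewrite pLE -EFinM lee_fin -(ler_pM2l (expR_gt0 t)).
move: (expR t) total => E total; lra.
Qed.

End single_user.

Lemma exists_small_error (R : realType) (Ka M m : nat) dU (U : measurableType dU)
    dV (V : measurableType dV) (c : randomized_code R Ka M m U V)
    d (Omega : measurableType d) (Pr : probability Omega R) (a : mac_use c Pr)
    (eps : R) : (0 < Ka)%N -> average_error a <= eps ->
  exists j, fine (Pr (error_event a j)) <= eps.
Proof.
move=> Ka0 err; apply: contrapT => /forallNP none.
have Ka0R : 0 < Ka%:R :> R by rewrite ltr0n.
have : \sum_(j < Ka) eps < \sum_(j < Ka) fine (Pr (error_event a j)).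
  apply: ltr_sum => [|j _]; last by rewrite ltNge; apply/negP; exact: none.
  by apply/hasP; exists (Ordinal Ka0); rewrite ?mem_index_enum.
rewrite sumr_const card_ord ltNge => /negP; apply.
by rewrite -mulr_natr -ler_pdivrMr// mulrC.
Qed.

Theorem mainTheorem1 (R : realType) (Ka : nat) (P : R)
    (hKa : (1 <= Ka)%N) (hP : 0 < P)
    (d0 : measure_display) (Omega0 : measurableType d0)
    (Pr0 : probability Omega0 R)
    (H : {RV Pr0 >-> R[i]}) (Z : nat -> {RV Pr0 >-> R[i]})
    (hH : is_CN01 Pr0 H) (hZ : forall i, is_CN01 Pr0 (Z i))
    (hHZ : mutual_independence Pr0
       (sum_family (fun _ : unit => sigma_rv H) (fun i : nat => sigma_rv (Z i))))
    (n : nat) (hn : (2 <= n)%N) (eps : R) (heps0 : 0 < eps) (heps1 : eps < 1)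
    (gamma : R)
    (hgamma : Pr0 [set o | info_S P H Z n o <= n%:R * gamma] = eps%:E)
    (M : nat)
    (dU : measure_display) (U : measurableType dU)
    (dV : measure_display) (V : measurableType dV)
    (c : randomized_code R Ka M n.-1 U V)
    (d : measure_display) (Omega : measurableType d)
    (Pr : probability Omega R) (a : mac_use c Pr)
    (hpower : max_power_constraint c P)
    (herror : average_error a <= eps) :
  ln (M%:R : R) <=
    ln (Ka%:R : R)
    + ln (1 / fine (Pr0 [set o | n%:R * gamma <= info_L P H Z n o])).
Proof.
(* With [n = m.+2] the code has blocklength [m.+1], and the completed codewords have length
   [m.+2]. *)
case: n hn hgamma c a hpower herror => [|[|m]] // _ hgamma c a hpower herror.
have [j err_j] := exists_small_error hKa herror.
have {}err_j : (Pr (error_event a j) <= eps%:E)%E.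
  by rewrite -(fineK (fin_num_measure Pr _ (measurable_error_event a j))) lee_fin.
move: (m.+2%:R * gamma) hgamma => t hgamma.
pose J : probability (R[i] * m.+2.-tuple R[i])%type R :=
  (complex_normal \x complex_gauss m.+2)%E.
pose LS := [set hz : R[i] * m.+2.-tuple R[i] | t < ref_S P hz].
pose LL := [set hz : R[i] * m.+2.-tuple R[i] | t < ref_L P hz].
pose X (o : Omega0) := (H o, [tuple Z i o | i < m.+2]).
have mX : measurable_fun [set: Omega0] X.
  by apply/measurable_fun_pair => /=; [|exact: measurable_mktuple].
have law A : measurable A -> J A = Pr0 (X @^-1` A).
  by move=> mA; apply/esym; exact: (law_reference hH hZ hHZ mA).
have mLS : measurable LS by exact: measurable_ref_S_gt.
have mLL : measurable LL by exact: measurable_ref_L_gt.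
have LS_prob : J LS = (1 - eps)%:E.
  rewrite law// -(setCK (X @^-1` LS)) probability_setC; last first.
    by apply: measurableC; exact: measurable_preimageT mLS.
  rewrite EFinB -hgamma; congr (_ - Pr0 _)%E.
  apply/seteqP; split=> w; rewrite /LS/= (@info_SE _ _ _ Pr0 P m.+2 H Z hP w).
    by move/negP; rewrite -leNgt.
  by move=> tS; apply/negP; rewrite -leNgt.
(* The weak inequality of the statement exceeds the strict test only by the event [L_n = t], which
   is null. *)
have LL_prob : Pr0 [set o | t <= info_L P H Z m.+2 o] = J LL.
  pose Leq := [set hz : R[i] * m.+2.-tuple R[i] | ref_L P hz = t].
  have mLeq : measurable Leq by exact: measurable_ref_L_eq.
  have JU : J (LL `|` Leq) = J LL.
    by apply: measureU0 => //; exact: joint_L_atomless.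
  rewrite -JU law; last exact: measurableU.
  congr (Pr0 _); apply/seteqP; split=> w;
    rewrite /LL /Leq /= (@info_LE _ _ _ Pr0 P m.+2 H Z hP w) le_eqVlt.
    by move=> /orP[/eqP <-|]; [right|left].
  by case=> [->|->]; rewrite ?orbT ?eqxx.
have LL_fin : J LL \is a fin_num by exact: fin_num_measure.
(* If [L_n > t] were null, [S_n > t] would be null too, although its probability is
   [1 - eps > 0]. *)
have LL_gt0 : 0 < fine (J LL).
  rewrite -lte_fin fineK// lt0e measure_ge0 andbT; apply/eqP => LL0.
  have : J LS = 0%E by exact: (joint_abs_cont hP LL0).
  rewrite LS_prob => -[] /eqP; rewrite subr_eq0 => /eqP eps1.
  by move: heps1; rewrite -eps1 ltxx.
have LS_le : (J LS <= (1 - eps)%:E)%E by rewrite LS_prob.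
have bound : (M%:R%:E * J LL <= Ka%:R%:E)%E.
  exact: (single_user_converse hP hpower err_j LS_le).
rewrite LL_prob; move: bound; rewrite -(fineK LL_fin) -EFinM lee_fin.
move: (fine (J LL)) LL_gt0 => p p0 bound.
have M0 : 0 < M%:R :> R.
  by rewrite ltr0n; apply: leq_ltn_trans (ltn_ord (message a j point)); exact: leq0n.
rewrite div1r lnV ?posrE// lerBrDr -lnM ?posrE// ler_ln ?posrE ?mulr_gt0//.
by rewrite ltr0n.
Qed.
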